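(* Let $K/\mathbb{Q}$ be an imaginary quadratic field with ring of integers $\mathcal{O}$, let $\mathfrak{m}$ be a nonzero integral ideal of $\mathcal{O}$, let $\ell$ be a prime and $n\ge 1$. Let $r\colon I(\mathfrak{m})\to \mathbb{F}_{\ell^n}^*$ be a group homomorphism such that: (i) there exists a prime ideal $\mathfrak{l}\mid\ell$ of $K$ such that $(\mathcal{O}/\mathfrak{l})^*$ embeds into $\mathbb{F}_{\ell^n}^*$; (ii) $\mathfrak{l}\mid\mathfrak{m}$; (iii) $\mathcal{O}^*$ embeds into $\mathbb{F}_{\ell^n}^*$; (iv) $P_1(\mathfrak{m})\subseteq\ker r$. Then there exist a prime ideal $\overline{\mathfrak{L}}\mid\ell$ of $\overline{\mathbb{Q}}$ and a Hecke character $\psi\colon I(\mathfrak{m})\to\overline{\mathbb{Q}}^*$ modulo $\mathfrak{m}$ such that $$\psi(\mathfrak{p})\equiv r(\mathfrak{p})\pmod{\overline{\mathfrak{L}}}$$ for all prime ideals $\mathfrak{p}$ in $I(\mathfrak{m})$.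
   Context: $I(\mathfrak{m})$ is the group of fractional ideals of $K$ coprime to $\mathfrak{m}$, and $P_1(\mathfrak{m})=\{(\alpha)\in I(\mathfrak{m}) : \alpha\equiv 1 \bmod \mathfrak{m}\}$. $\overline{\mathbb{Q}}$ is the algebraic closure of $\mathbb{Q}$ in $\mathbb{C}$, and $K\subset\overline{\mathbb{Q}}$. A Hecke character (of type $(1,0)$) modulo $\mathfrak{m}$ is a group homomorphism $\psi\colon I(\mathfrak{m})\to\mathbb{C}^*$ such that $\psi((\alpha))=\alpha$ for all $\alpha\equiv 1\pmod{\mathfrak{m}}$. A prime ideal $\overline{\mathfrak L}\mid \ell$ of $\overline{\mathbb{Q}}$ is a maximal ideal of the ring of algebraic integers containing $\ell$; its residue field is an algebraic closure of $\mathbb{F}_\ell$, and $\mathbb{F}_{\ell^n}$ is regarded as a subfield of it via a field embedding, which gives meaning to the congruence between $\psi(\mathfrak{p})$ and $r(\mathfrak{p})$. *)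

(* Defs.v *)
From HB Require Import structures.
From mathcomp Require Import all_boot all_order all_algebra all_fingroup all_field.
From mathcomp Require Import ring_quotient generic_quotient.
From mathcomp Require Import boolp classical_sets.

Set Implicit Arguments.
Unset Strict Implicit.
Unset Printing Implicit Defensive.

Import Order.TTheory GRing.Theory Num.Theory.
Local Open Scope classical_set_scope.
Local Open Scope ring_scope.

Section RingOfIntegers.
Variable K : fieldType.

Definition integral_over_Z : {pred K} :=
  fun x => `[< integralOver (intr : int -> K) x >].

Lemma integral_over_Z_subring : subring_closed integral_over_Z.
Proof.
split=> [|x y /asboolP ix /asboolP iy|x y /asboolP ix /asboolP iy];
  apply/asboolP.
- exact: integral1.
- exact: integral_sub.
- exact: integral_mul.
Qed.

HB.instance Definition _ :=
  GRing.isSubringClosed.Build K integral_over_Z integral_over_Z_subring.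

Definition integers := {x : K | x \in integral_over_Z}.

HB.instance Definition _ := [isSub of integers for @sval _ _].
HB.instance Definition _ := [Choice of integers by <:].
HB.instance Definition _ := [SubChoice_isSubComNzRing of integers by <:].

End RingOfIntegers.

Definition Zbar := {x : algC | x \in Aint}.

HB.instance Definition _ := [isSub of Zbar for @sval _ _].
HB.instance Definition _ := [Choice of Zbar by <:].
HB.instance Definition _ := [SubChoice_isSubComNzRing of Zbar by <:].

Definition imaginary_quadratic (K : fieldExtType rat)
    (iota : {rmorphism K -> algC}) : Prop :=
  \dim {: K} = 2%N /\ exists x : K, iota x \isn't Num.real.

(* Fractional ideals are subsets of K; the zero ideal is excluded. *)
Section Ideals.
Variable K : fieldType.
Implicit Types (I J A B m : set K) (x y a b alpha : K).

Definition fractional_ideal I : Prop :=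
  [/\ exists2 x, I x & x != 0,
      forall x y, I x -> I y -> I (x + y),
      forall (c : integers K) x, I x -> I (val c * x)
    & exists2 d : integers K, d != 0 &
        forall x, I x -> val d * x \in @integral_over_Z K].

Definition integral_ideal I : Prop :=
  fractional_ideal I /\ forall x, I x -> x \in @integral_over_Z K.

Definition mul_ideal I J : set K :=
  [set x | exists2 s : seq (K * K),
     forall p, p \in s -> I p.1 /\ J p.2 & x = \sum_(p <- s) p.1 * p.2].

Definition principal_ideal alpha : set K :=
  [set alpha * val c | c in [set: integers K]].

Definition ideal_set (p : {pred integers K}) : set K :=
  [set val c | c in [set c | c \in p]].

Definition divides_ideal I J : Prop :=
  exists2 A, integral_ideal A & J = mul_ideal I A.

Definition coprime_ideals A B : Prop :=
  exists x y, [/\ A x, B y & x + y = 1].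

(* I(m): the fractional ideals A B^-1 with A, B integral and coprime to m,
   with I = A B^-1 written as I B = A. *)
Definition ideals_coprime_to m : set (set K) :=
  [set I | fractional_ideal I /\
     exists A B, [/\ integral_ideal A, integral_ideal B,
                     coprime_ideals A m, coprime_ideals B m
                   & mul_ideal I B = A]].

(* Multiplicative congruence alpha = 1 mod m for alpha in K^*: alpha = a / b
   with b coprime to m and a = b mod m. *)
Definition congr1_mod m alpha : Prop :=
  alpha != 0 /\
  exists a b : integers K,
    [/\ b != 0, coprime_ideals (principal_ideal (val b)) m,
        m (val a - val b) & alpha = val a / val b].

Definition P1 m : set (set K) :=
  [set I | ideals_coprime_to m I /\
     exists2 alpha, congr1_mod m alpha & I = principal_ideal alpha].

(* Here iota is the inclusion of K in Qbar = algC.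
   A group homomorphism psi : I(m) -> Qbar^* is a function on all subsets of K
   whose values outside I(m) are irrelevant. *)
Definition hecke_character (iota : K -> algC) m (psi : set K -> algC) : Prop :=
  [/\ forall I, ideals_coprime_to m I -> psi I != 0,
      forall I J, ideals_coprime_to m I -> ideals_coprime_to m J ->
        psi (mul_ideal I J) = psi I * psi J
    & forall alpha, congr1_mod m alpha ->
        psi (principal_ideal alpha) = iota alpha].

End Ideals.

(* R^* embeds into F^* as a group; the type {unit R} requires a finite ring with
   a boolean unit predicate, hence units are described by a Prop. *)
Definition units_embed (R : comNzRingType) (F : finFieldType) : Prop :=
  let is_unit (x : R) := exists y, x * y = 1 in
  exists f : R -> {unit F},
    (forall x y, is_unit x -> is_unit y -> f (x * y) = (f x * f y)%g) /\
    (forall x y, is_unit x -> is_unit y -> f x = f y -> x = y).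

(* The type idealr only contains proper ideals. *)
Definition maximal_ideal (R : nzRingType) (L : idealr R) : Prop :=
  forall J : idealr R, {subset L <= J} -> {subset J <= L}.

(* Main.v *)
(* Let L be a maximal ideal of Zbar above l.  A unit of K congruent to 1 modulo m
   is congruent to 1 modulo l, and its order is prime to ell by (iii), so it is
   1: hence (alpha) |-> alpha is a well-defined homomorphism on P1(m), and modulo
   L it is trivial, as r is.  The L-units of Qbar congruent to 1 modulo L form a
   divisible group, because y^n - w^n is a product of factors y - zeta w, one of
   which lies in L as soon as the product does.  By Zorn's lemma the homomorphism
   therefore extends to a lift of r on the whole of I(m).  Finally I(m)/P1(m) is
   torsion (Hurwitz' proof of the finiteness of the class number, by pigeonhole),
   so some power of psi(p) is an integer of K and psi(p) is an algebraic
   integer. *)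

Require Import Defs.
From HB Require Import structures.
From mathcomp Require Import all_boot all_order all_algebra all_fingroup all_field.
From mathcomp Require Import ring_quotient generic_quotient cyclic.
From mathcomp Require Import boolp classical_sets.
From mathcomp Require Import zify ring lra.

Set Implicit Arguments.
Unset Strict Implicit.
Unset Printing Implicit Defensive.

Import Order.TTheory GRing.Theory Num.Theory.
Local Open Scope ring_scope.
Local Open Scope quotient_scope.

(** * Imaginary quadratic fields *)

(** The values of psi are in general only L-units, so congruence modulo L is stated for fractions a
    / b with b outside L and becomes a congruence in Zbar only where psi is integral. The extension
    runs through pairs (v, x) with x reducing to r(v), which spares a multiplicative section of the
    reduction map; divisibility then appears as the extraction, over v, of an n-th root of any value
    over n v. L is taken above l, not merely above ell: this is what makes alpha = 1 mod m imply
    alpha = 1 mod L. It is fixed before the embedding j of F, and psi is found for every j.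
    Factorization into primes is avoided: ideals are inverted by means of conjugation, and
    coprimality is an equation x + y = 1. *)

Definition ratK (K : fieldExtType rat) (q : rat) : K := q%:A.

HB.instance Definition _ (K : fieldExtType rat) :=
  GRing.RMorphism.copy (@ratK K) (in_alg K).

Arguments ratK {K} q.

Section ImaginaryQuadratic.
Variables (K : fieldExtType rat) (iota : {rmorphism K -> algC}).

Lemma ratKE (q : rat) : q%:A = ratK q :> K. Proof. by []. Qed.

Lemma natK_eq0 (n : nat) : (n%:R == 0 :> K) = (n == 0%N).
Proof. by rewrite -(rmorph_nat (@ratK K)) fmorph_eq0 pnatr_eq0. Qed.

Lemma iota_ratK (q : rat) : iota (ratK q) = ratr q.
Proof. exact: (fmorph_eq_rat (iota \o @ratK K)). Qed.

(** D need not be squarefree, nor need [delta] generate the ring of integers: integrality in K is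
    later read off from trace and norm. *)
Lemma imaginary_quadratic_basis : imaginary_quadratic iota ->
  exists (D : nat) (delta : K), [/\ (0 < D)%N, delta ^+ 2 = - (D%:R) &
    forall z, exists uv : rat * rat, z = ratK uv.1 + ratK uv.2 * delta].
Proof.
case=> dimK [x xNreal].
have ratNx (q : rat) : x != ratK q.
  apply: contraNneq xNreal => ->; rewrite iota_ratK.
  by apply: Creal_Crat; apply: Crat_rat.
have span (y : K) : (forall q : rat, y != ratK q) ->
    forall z, exists uv : rat * rat, z = ratK uv.1 + ratK uv.2 * y.
  move=> yNrat z.
  have dis : (<[1 : K]> :&: <[y]> = 0)%VS.
    apply/eqP; rewrite -subv0; apply/subvP => w /memv_capP[/vlineP[a ->]].
    case/vlineP=> b; have [->|b0] := eqVneq b 0.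
      by rewrite scale0r => ->; rewrite mem0v.
    move=> ab; case/eqP: (yNrat (b^-1 * a)); rewrite -ratKE.
    by rewrite -scalerA ab scalerA mulVf // scale1r.
  have y0 : y != 0 by have := yNrat 0; rewrite rmorph0.
  have full : (<[1 : K]> + <[y]>)%VS = fullv.
    apply/eqP; rewrite eqEdim subvf dimvf /=.
    by rewrite dimv_disjoint_sum // !dim_vline oner_eq0 y0 -dimvf dimK.
  have: z \in (<[1 : K]> + <[y]>)%VS by rewrite full memvf.
  case/memv_addP=> _ /vlineP[a ->] [_ /vlineP[b ->] ->].
  by exists (a, b); rewrite -!ratKE mulr_algl.
have [[a b] /= x2] := span x ratNx (x ^+ 2).
(* Completing the square in x^2 = a + b x gives (x - b/2)^2 = e; scaling by the denominator of e
   turns the square into an integer. *)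
pose e := a + b ^+ 2 / 4%:R; pose y := ratK (denq e)%:~R * (x - ratK (b / 2%:R)).
have y2 : y ^+ 2 = ratK ((numq e * denq e)%:~R).
  have ->: (numq e * denq e)%:~R = e * (denq e)%:~R ^+ 2 :> rat.
    by rewrite intrM expr2 mulrA -numqE.
  have: x ^+ 2 = ratK a + ratK b * x by [].
  rewrite /y; set d := (denq e)%:~R; clearbody d; rewrite exprMn sqrrB => ->; rewrite /e.
  by field; rewrite !natK_eq0.
have yNreal : iota y \isn't Num.real.
  apply: contra xNreal => yr.
  have d0 : ratK (denq e)%:~R != 0 :> K by rewrite fmorph_eq0 intr_eq0 denq_neq0.
  have -> : x = y / ratK (denq e)%:~R + ratK (b / 2%:R).
    by rewrite /y mulrAC mulfV // mul1r subrK.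
  rewrite rmorphD fmorph_div !iota_ratK.
  by apply: rpredD; [apply: rpred_div yr _|]; apply: Creal_Crat; apply: Crat_rat.
have yNrat q : y != ratK q.
  apply: contraNneq yNreal => ->; rewrite iota_ratK.
  by apply: Creal_Crat; apply: Crat_rat.
(* A nonnegative square would make [iota y] real. *)
have neg : numq e * denq e < 0.
  rewrite ltNge; apply: contra yNreal => ge0.
  by rewrite realEsqr -rmorphXn y2 iota_ratK ratr_int ler0z.
exists (absz (numq e * denq e)), y; split.
- by rewrite absz_gt0 lt_eqF.
- rewrite y2 rmorph_int /= -[LHS]opprK -mulrNz -lez0_abs ?(ltW neg) //.
- exact: span.
Qed.
End ImaginaryQuadratic.

(** Z is integrally closed: the root is transported to [algC], where rational algebraic integers are
    known to be integers. *)
Lemma ratK_integral (K : fieldExtType rat) (q : rat) :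
  ((ratK q : K) \in @integral_over_Z K) = (q \is a Num.int).
Proof.
apply/idP/idP => [/asboolP[p mon_p]|/intrP[k ->]]; last first.
  by rewrite rmorph_int; apply: rpred_int.
have mapK (L : nzRingType) (f : {rmorphism rat -> L}) :
    map_poly intr p = map_poly f (map_poly intr p).
  by rewrite -map_poly_comp; apply: eq_map_poly => k /=; rewrite rmorph_int.
rewrite (mapK _ (@ratK K)) fmorph_root -(fmorph_root (@ratr algC)) -mapK => rt.
have qA : ratr q \in Aint.
  by apply: root_monic_Aint rt _ _; [exact: monic_map|];
     apply/polyOverP=> i; rewrite coef_map /= intr_int.
have /intrP[k qk] := Cint_rat_Aint (Crat_rat q) qA.
by apply/intrP; exists k; apply: (fmorph_inj (@ratr algC)); rewrite rmorph_int; exact: qk.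
Qed.

(** Uniqueness of the coordinates is not a field: it follows from [qD_gt0], because -D is then not a
    rational square. *)
Record quadratic (K : fieldExtType rat) := Quadratic {
  qD : nat;
  qdelta : K;
  qre : K -> rat;
  qim : K -> rat;
  qD_gt0 : (0 < qD)%N;
  qdelta2 : qdelta ^+ 2 = - qD%:R;
  quadE : forall z, z = ratK (qre z) + ratK (qim z) * qdelta }.

Lemma imaginary_quadratic_coords (K : fieldExtType rat)
    (iota : {rmorphism K -> algC}) :
  imaginary_quadratic iota -> inhabited (quadratic K).
Proof.
case/imaginary_quadratic_basis=> D [delta [D0 d2 /choice[f fE]]].
by constructor; exists D delta (fun z => (f z).1) (fun z => (f z).2).
Qed.

(** * Conjugation, trace and norm *)

Section Conjugation.
Variables (K : fieldExtType rat) (q : quadratic K).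
Local Notation D := (qD q).
Local Notation delta := (qdelta q).
Local Notation re := (qre q).
Local Notation im := (qim q).
Local Notation OO := (@integral_over_Z K).

Lemma quad_inj u v u' v' :
  ratK u + ratK v * delta = ratK u' + ratK v' * delta -> u = u' /\ v = v'.
Proof.
move=> e.
have e0 : ratK (u - u') = ratK (v' - v) * delta.
  apply/eqP; rewrite -subr_eq0; move/eqP: e; rewrite -subr_eq0 => /eqP <-.
  by apply/eqP; ring.
have [v0|v0] := eqVneq (v' - v) 0.
  move: e0; rewrite v0 rmorph0 mul0r => /eqP; rewrite fmorph_eq0 subr_eq0.
  by move=> /eqP ->; split=> //; apply/eqP; rewrite eq_sym -subr_eq0 v0.
have : ratK ((u - u') ^+ 2 + D%:R * (v' - v) ^+ 2) = 0 :> K.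
  have d2 := qdelta2 q; rewrite rmorphD rmorphXn /= e0; by ring: d2.
move/eqP; rewrite fmorph_eq0 paddr_eq0 ?sqr_ge0 //; last first.
  by rewrite mulr_ge0 ?sqr_ge0.
case/andP=> _; rewrite mulf_eq0 sqrf_eq0 (negPf v0) orbF pnatr_eq0.
by rewrite (gtn_eqF (qD_gt0 q)).
Qed.

Lemma quad_coords z u v : z = ratK u + ratK v * delta -> re z = u /\ im z = v.
Proof. by rewrite {1}[z](quadE q) => /quad_inj. Qed.

Lemma quad_ratK u : re (ratK u) = u /\ im (ratK u) = 0.
Proof. by apply: quad_coords; rewrite rmorph0 mul0r addr0. Qed.

Lemma quadB x y : re (x - y) = re x - re y /\ im (x - y) = im x - im y.
Proof.
apply: quad_coords; rewrite {1}[x](quadE q) {1}[y](quadE q) !rmorphB /=; ring.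
Qed.

Lemma quadM x y : re (x * y) = re x * re y - D%:R * im x * im y /\
  im (x * y) = re x * im y + im x * re y.
Proof.
apply: quad_coords; rewrite {1}[x](quadE q) {1}[y](quadE q).
rewrite !(rmorphB, rmorphD, rmorphM) rmorph_nat /=.
have d2 := qdelta2 q.
by ring: d2.
Qed.

Definition conjq z := ratK (re z) - ratK (im z) * delta.
Definition normq z : rat := re z ^+ 2 + D%:R * im z ^+ 2.

Lemma conjq_zmod : zmod_morphism conjq.
Proof. by move=> x y; rewrite /conjq (quadB x y).1 (quadB x y).2 !rmorphB /=; ring. Qed.

Lemma conjq_monoid : monoid_morphism conjq.
Proof.
split=> [|x y].
  by rewrite /conjq -(rmorph1 (@ratK K)) (quad_ratK 1).1 (quad_ratK 1).2 rmorph0 mul0r subr0.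
rewrite /conjq (quadM x y).1 (quadM x y).2.
rewrite !(rmorphB, rmorphD, rmorphM) rmorph_nat /=.
have d2 := qdelta2 q.
by ring: d2.
Qed.

HB.instance Definition _ := GRing.isZmodMorphism.Build K K conjq conjq_zmod.
HB.instance Definition _ := GRing.isMonoidMorphism.Build K K conjq conjq_monoid.

Lemma conjq_mul z : z * conjq z = ratK (normq z).
Proof.
rewrite {1}[z](quadE q) /conjq /normq rmorphD rmorphM !rmorphXn rmorph_nat /=.
have d2 := qdelta2 q.
by ring: d2.
Qed.

Lemma conjq_add z : z + conjq z = ratK (re z *+ 2).
Proof. by rewrite {1}[z](quadE q) /conjq rmorphMn /=; ring. Qed.

Lemma normqM x y : normq (x * y) = normq x * normq y.
Proof. by rewrite /normq (quadM x y).1 (quadM x y).2; ring. Qed.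

Lemma normq_ratK u : normq (ratK u) = u ^+ 2.
Proof. by rewrite /normq (quad_ratK u).1 (quad_ratK u).2; ring. Qed.

Lemma normq_ge0 z : 0 <= normq z.
Proof. by apply: addr_ge0; rewrite ?sqr_ge0 // mulr_ge0 ?sqr_ge0 ?ler0n. Qed.

Lemma normq_eq0 z : (normq z == 0) = (z == 0).
Proof. by rewrite -(fmorph_eq0 (@ratK K)) /= -conjq_mul mulf_eq0 fmorph_eq0 orbb. Qed.

Lemma normq_gt0 z : z != 0 -> 0 < normq z.
Proof. by move=> z0; rewrite lt_def normq_eq0 z0 normq_ge0. Qed.

Lemma conjqK : involutive conjq.
Proof.
move=> z; rewrite {2}[z](quadE q) {1}/conjq.
have [-> ->] : re (conjq z) = re z /\ im (conjq z) = - im z.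
  by apply: quad_coords; rewrite rmorphN mulNr.
by rewrite rmorphN mulNr opprK.
Qed.

Lemma normq_cj z : normq (conjq z) = normq z.
Proof. by apply: (fmorph_inj (@ratK K)); rewrite /= -!conjq_mul mulrC conjqK. Qed.

Lemma integral_conjq z : z \in OO -> conjq z \in OO.
Proof.
move=> /asboolP[p mon_p /eqP pz]; apply/asboolP; exists p => //.
apply/rootP; rewrite -[RHS](rmorph0 conjq) -pz -horner_map -map_poly_comp.
by congr (_.[_]); apply: eq_map_poly => k; rewrite /= rmorph_int.
Qed.

(** Trace and norm of an integral z are rational and integral; conversely z is a root of X^2 - Tr(z)
    X + N(z). This criterion replaces an integral basis. *)
Lemma integral_quad z :
  (z \in OO) = (re z *+ 2 \is a Num.int) && (normq z \is a Num.int).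
Proof.
apply/idP/andP => [zO|[/intrP[t tE] /intrP[n nE]]].
  by rewrite -!(ratK_integral K) -conjq_mul -conjq_add rpredD ?rpredM ?integral_conjq.
apply/asboolP; exists ('X^2 + (n%:P - t *: 'X)).
  rewrite monicE lead_coefDl ?lead_coefXn // size_polyXn ltnS.
  rewrite (leq_trans (size_polyD _ _)) // geq_max size_polyN.
  rewrite (leq_trans (size_polyC_leq1 _)) //.
  by rewrite (leq_trans (size_scale_leq _ _)) // size_polyX.
apply/rootP; rewrite rmorphD rmorphB /= map_polyXn map_polyC linearZ /=.
rewrite map_polyX !hornerE /= -!(rmorph_int (@ratK K)) -tE -nE /=.
by rewrite -conjq_mul -conjq_add; ring.
Qed.
End Conjugation.

(** * Arithmetic of fractional ideals *)

Section IdealArithmetic.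
Local Open Scope classical_set_scope.
Variable K : fieldType.
Implicit Types (I J A B m : set K) (x y z a b : K).
Local Notation OO := (@integral_over_Z K).

Definition order_set : set K := [set x | x \in OO].

(** Weaker than [fractional_ideal]: the zero module and unbounded denominators are allowed, which
    removes side conditions from the algebra of products. *)
Definition submodule I : Prop :=
  [/\ I 0, forall x y, I x -> I y -> I (x + y)
    & forall c x, c \in OO -> I x -> I (c * x)].

Lemma order_submodule : submodule order_set.
Proof.
by split=> [|x y|x y]; rewrite /order_set /= ?rpred0 //;
   [apply: rpredD|apply: rpredM].
Qed.

Lemma fractional_submodule I : fractional_ideal I -> submodule I.
Proof.
case=> [[x Ix _] ID IM _]; have IM' c z : c \in OO -> I z -> I (c * z).
  by move=> cO; apply: (IM (Sub c cO : integers K)).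
by split=> //; rewrite -(mul0r x); apply: IM'; rewrite ?rpred0.
Qed.

Lemma submodule_fractional I : submodule I ->
  (exists2 x, I x & x != 0) ->
  (exists d, [/\ d \in OO, d != 0 & forall x, I x -> d * x \in OO]) ->
  fractional_ideal I.
Proof.
move=> [I0 ID IM] Inz [d [dO d0 dI]]; split=> // [c x|]; first exact/IM/(valP c).
by exists (Sub d dO : integers K).
Qed.

Lemma submoduleB I x y : submodule I -> I x -> I y -> I (x - y).
Proof.
move=> [_ ID IM] Ix Iy; apply: ID => //; rewrite -mulN1r; apply: IM => //.
by rewrite rpredN rpred1.
Qed.

Lemma mem_mul_ideal I J x y : I x -> J y -> mul_ideal I J (x * y).
Proof.
move=> Ix Jy; exists [:: (x, y)]; last by rewrite big_seq1.
by move=> p; rewrite inE => /eqP ->.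
Qed.

Lemma mul_ideal0 I J : mul_ideal I J 0.
Proof. by exists [::]; rewrite // big_nil. Qed.

Lemma mul_idealD I J x y :
  mul_ideal I J x -> mul_ideal I J y -> mul_ideal I J (x + y).
Proof.
move=> [s sP ->] [t tP ->]; exists (s ++ t); last by rewrite big_cat.
by move=> p; rewrite mem_cat => /orP[/sP|/tP].
Qed.

(** Elimination principle for products: an additive condition is checked on the generators x y only.
    In its uses [C] is often a condition on a multiple of the element. *)
Lemma mul_ideal_sub I J (C : set K) :
  C 0 -> (forall x y, C x -> C y -> C (x + y)) ->
  (forall x y, I x -> J y -> C (x * y)) -> mul_ideal I J `<=` C.
Proof.
move=> C0 CD CM _ [s sP ->]; elim: s sP => [|p s IH] sP; first by rewrite big_nil.
rewrite big_cons; apply: CD.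
  by have [] := sP p (mem_head _ _); apply: CM.
by apply: IH => r rs; apply: sP; rewrite inE rs orbT.
Qed.

Lemma mul_idealC I J : mul_ideal I J = mul_ideal J I.
Proof.
by apply/seteqP; split; apply: mul_ideal_sub;
  do ?[exact: mul_ideal0|exact: mul_idealD];
  move=> x y Ix Jy; rewrite mulrC; apply: mem_mul_ideal.
Qed.

Lemma mul_idealA I J A :
  mul_ideal I (mul_ideal J A) = mul_ideal (mul_ideal I J) A.
Proof.
apply/seteqP; split; apply: mul_ideal_sub;
  do ?[exact: mul_ideal0|exact: mul_idealD].
- move=> x y Ix; apply: (mul_ideal_sub (C := fun y => mul_ideal _ _ (x * y))).
  + by rewrite mulr0; apply: mul_ideal0.
  + by move=> u v; rewrite mulrDr; apply: mul_idealD.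
  + by move=> u v Ju Av; rewrite mulrA; do 2?apply: mem_mul_ideal.
- move=> x y + Ay; move: x.
  apply: (mul_ideal_sub (C := fun x => mul_ideal _ _ (x * y))).
  + by rewrite mul0r; apply: mul_ideal0.
  + by move=> u v; rewrite mulrDl; apply: mul_idealD.
  + by move=> u v Iu Jv; rewrite -mulrA; do 2?apply: mem_mul_ideal.
Qed.

Lemma mul_ideal_submodule I J : submodule I -> submodule (mul_ideal I J).
Proof.
move=> [_ _ IM]; split; [exact: mul_ideal0|exact: mul_idealD|].
move=> c x cO; move: x; apply: (mul_ideal_sub (C := fun x => mul_ideal _ _ (c * x))).
- by rewrite mulr0; apply: mul_ideal0.
- by move=> u v; rewrite mulrDr; apply: mul_idealD.
- by move=> u v Iu Jv; rewrite mulrA; apply: mem_mul_ideal => //; apply: IM.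
Qed.

Lemma mul_ideal_le I J A : submodule A ->
  (forall x y, I x -> J y -> A (x * y)) -> mul_ideal I J `<=` A.
Proof. by case=> A0 AD _; apply: mul_ideal_sub. Qed.

Lemma mul_order_ideal I : submodule I -> mul_ideal order_set I = I.
Proof.
move=> sI; apply/seteqP; split=> [|x Ix].
  by apply: mul_ideal_le => // x y xO Iy; case: sI => _ _; apply.
by rewrite -[x]mul1r; apply: mem_mul_ideal => //; apply: rpred1.
Qed.

Lemma fractional_order : fractional_ideal order_set.
Proof.
apply: (submodule_fractional order_submodule).
  by exists 1; [apply: rpred1|apply: oner_neq0].
by exists 1; split=> [||x]; rewrite ?rpred1 ?oner_neq0 ?mul1r.
Qed.

Lemma fractional_denom I : fractional_ideal I ->
  exists d, [/\ d \in OO, d != 0 & forall x, I x -> d * x \in OO].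
Proof. by case=> _ _ _ [d d0 dI]; exists (val d); split=> //; apply: valP. Qed.

Lemma fractional_mul I J :
  fractional_ideal I -> fractional_ideal J -> fractional_ideal (mul_ideal I J).
Proof.
move=> fI fJ; have [d [dO d0 dI]] := fractional_denom fI.
have [e [eO e0 eJ]] := fractional_denom fJ.
have [[x Ix x0] _ _ _] := fI; have [[y Jy y0] _ _ _] := fJ.
apply: submodule_fractional.
- exact/mul_ideal_submodule/fractional_submodule.
- by exists (x * y); [apply: mem_mul_ideal|rewrite mulf_neq0].
exists (d * e); split; rewrite ?rpredM ?mulf_neq0 //.
apply: (mul_ideal_sub (C := fun z => d * e * z \in OO)).
- by rewrite mulr0 rpred0.
- by move=> u v; rewrite mulrDr; apply: rpredD.
- by move=> u v Iu Jv; rewrite mulrACA rpredM ?dI ?eJ.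
Qed.

Lemma principalP a x :
  principal_ideal a x <-> exists2 c, c \in OO & x = a * c.
Proof.
split=> [[c _ <-]|[c cO ->]]; first by exists (val c); rewrite ?(valP c).
by exists (Sub c cO).
Qed.

Lemma principal_submodule a : submodule (principal_ideal a).
Proof.
split=> [|x y /principalP[c cO ->] /principalP[e eO ->]|c x cO /principalP[e eO ->]];
  apply/principalP.
- by exists 0; rewrite ?rpred0 ?mulr0.
- by exists (c + e); rewrite ?rpredD ?mulrDr.
- by exists (c * e); rewrite ?rpredM // mulrCA.
Qed.

Lemma mem_principal a : principal_ideal a a.
Proof. by apply/principalP; exists 1; rewrite ?rpred1 ?mulr1. Qed.

Lemma principal1 : principal_ideal 1 = order_set.
Proof.
apply/seteqP; split=> [x /principalP[c cO ->]|x xO]; first by rewrite mul1r.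
by apply/principalP; exists x; rewrite ?mul1r.
Qed.

Lemma principal_mul a b :
  mul_ideal (principal_ideal a) (principal_ideal b) = principal_ideal (a * b).
Proof.
apply/seteqP; split.
  apply: mul_ideal_le; first exact: principal_submodule.
  move=> x y /principalP[c cO ->] /principalP[e eO ->]; apply/principalP.
  by exists (c * e); rewrite ?rpredM // mulrACA.
move=> x /principalP[c cO ->]; rewrite -mulrA; apply: mem_mul_ideal.
  exact: mem_principal.
by apply/principalP; exists c.
Qed.

Lemma mul_principal a I x : submodule I ->
  mul_ideal (principal_ideal a) I x <-> exists2 y, I y & x = a * y.
Proof.
move=> [I0 ID IM]; split=> [|[y Iy ->]]; last first.
  by apply: mem_mul_ideal => //; apply: mem_principal.
move: x; apply: mul_ideal_sub => [|x y [u Iu ->] [v Iv ->]|_ y /principalP[c cO ->] Iy].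
- by exists 0; rewrite ?mulr0.
- by exists (u + v); rewrite ?mulrDr //; apply: ID.
- by exists (c * y); [apply: IM|rewrite mulrA].
Qed.

Lemma fractional_principal a : (exists2 d, d \in OO & d != 0 /\ d * a \in OO) ->
  a != 0 -> fractional_ideal (principal_ideal a).
Proof.
move=> [d dO [d0 daO]] a0; apply: submodule_fractional.
- exact: principal_submodule.
- by exists a => //; apply: mem_principal.
by exists d; split=> // x /principalP[c cO ->]; rewrite mulrA rpredM.
Qed.

(** The colon ideal (O : I). *)
Definition inv_ideal I : set K := [set z | forall x, I x -> z * x \in OO].

Lemma fractional_inv I : fractional_ideal I -> fractional_ideal (inv_ideal I).
Proof.
move=> fI; have [d [dO d0 dI]] := fractional_denom fI.
have [[x Ix x0] _ _ _] := fI; apply: submodule_fractional.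
- split=> [y _|y z yI zI w Iw|c y cO yI w Iw]; first by rewrite mul0r rpred0.
    by rewrite mulrDl rpredD ?yI ?zI.
  by rewrite -mulrA rpredM ?yI.
- by exists d.
exists (d * x); split; rewrite ?dI ?mulf_neq0 // => z zI.
by rewrite -mulrA rpredM // mulrC zI.
Qed.
End IdealArithmetic.

(** N T is a nonzero subgroup of the integers, and g corresponds to its least positive member; the
    quotient is integral by Euclidean division. *)
Lemma rat_subgroup_cyclic (T : rat -> Prop) (N : rat) (r0 : rat) :
  (forall r s, T r -> T s -> T (r - s)) -> T r0 -> r0 != 0 ->
  N != 0 -> (forall r, T r -> N * r \is a Num.int) ->
  exists g, [/\ T g, g != 0 & forall r, T r -> r / g \is a Num.int].
Proof.
move=> TB Tr0 r00 N0 NT.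
have T0 : T 0 by move: (TB _ _ Tr0 Tr0); rewrite subrr.
have TN r : T r -> T (- r) by move=> /(TB _ _ T0); rewrite sub0r.
have TM r (k : int) : T r -> T (r * k%:~R).
  move=> Tr; have Tn (n : nat) : T (r * n%:R).
    elim: n => [|n IH]; first by rewrite mulr0.
    by rewrite -natr1 mulrDr mulr1 -[r in _ + r]opprK; apply/TB/TN.
  case: k => n; first exact: Tn.
  by rewrite NegzE rmorphN mulrN; apply: TN; apply: Tn.
pose P (k : nat) := `[< (0 < k)%N /\ exists2 r, T r & N * r = k%:R >].
have exP : exists k, P k.
  have /intrP[k kE] := NT _ Tr0.
  have k0 : k != 0.
    by apply: contraNneq N0 => k0; move/eqP: kE; rewrite k0 mulf_eq0 (negPf r00) orbF.
  exists (absz k); apply/asboolP; split; first by rewrite absz_gt0.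
  exists (r0 * (sgz k)%:~R); first exact: TM.
  by rewrite mulrA kE -intrM mulrC -abszEsg.
have [k /asboolP[k0 [g Tg gE]] kmin] := ex_minnP exP.
have g0 : g != 0.
  by apply: contraTneq k0 => g0; move/eqP: gE; rewrite g0 mulr0 eq_sym pnatr_eq0 -leqNgt leqn0.
exists g; split=> // r Tr; have /intrP[a aE] := NT _ Tr.
pose b := (a %/ k)%Z; pose s := r - g * b%:~R.
have Ts : T s by apply: TB => //; apply: TM.
have k0z : (k : int) != 0 by rewrite eqz_nat -lt0n.
have sE : N * s = (absz (a %% k)%Z)%:R.
  rewrite pmulrn gez0_abs ?modz_ge0 // mulrBr mulrA gE aE.
  by rewrite {1}(divz_eq a k) intrD intrM addrAC mulrC subrr add0r.
have [z0|z0] := posnP (absz (a %% k)%Z).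
  have : s = 0 by apply/eqP; move/eqP: sE; rewrite z0 mulf_eq0 (negPf N0).
  by move/eqP; rewrite subr_eq0 => /eqP ->; rewrite mulrAC mulfV // mul1r rpred_int.
suff: (k <= absz (a %% k)%Z)%N.
  by rewrite leqNgt -ltz_nat gez0_abs ?modz_ge0 // ltz_pmod.
by apply: kmin; apply/asboolP; split=> //; exists s.
Qed.

(** * Invertibility of fractional ideals *)

Section InverseIdeal.
Local Open Scope classical_set_scope.
Variables (K : fieldExtType rat) (q : quadratic K).
Local Notation OO := (@integral_over_Z K).

(* Hurwitz: the rational numbers in the product of I with its conjugate form a
   cyclic group; if g is a generator, then x * conjq y / g has integral trace and
   norm for all x and y in I, so conjq y / g lies in the inverse of I. *)
Lemma mul_ideal_inv (I : set K) : fractional_ideal I ->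
  mul_ideal I (inv_ideal I) = @order_set K.
Proof.
move=> fI; have [d [dO d0 dI]] := fractional_denom fI.
have [[x0 Ix0 x00] _ _ _] := fI; have sI := fractional_submodule fI.
pose cI := [set conjq q x | x in I].
have sP : submodule (mul_ideal I cI) by apply: mul_ideal_submodule.
pose T r := mul_ideal I cI (ratK r).
have [r s||||r Tr|g [Tg g0 gT]] := @rat_subgroup_cyclic T (normq q d) (normq q x0).
- by rewrite /T rmorphB; apply: submoduleB.
- by rewrite /T -conjq_mul; apply: mem_mul_ideal => //; exists x0.
- by rewrite normq_eq0.
- by rewrite normq_eq0.
(* N(d) = d * conjq d clears the denominators of the product of I with its conjugate. *)
- rewrite -(ratK_integral K) rmorphM /= -conjq_mul.
  move: Tr; rewrite /T; apply: (mul_ideal_sub (C := fun z => d * conjq q d * z \in OO)).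
  + by rewrite mulr0 rpred0.
  + by move=> u v; rewrite [_ * (u + v)]mulrDr; apply: rpredD.
  + move=> x _ Ix [y Iy <-]; rewrite mulrACA -rmorphM.
    by rewrite rpredM ?integral_conjq ?dI.
have gK0 : ratK g != 0 :> K by rewrite fmorph_eq0.
have inv y : I y -> inv_ideal I (conjq q y / ratK g).
  move=> Iy x Ix; rewrite mulrAC mulrC -fmorphV (integral_quad q).
  have [TxT nmT] : T (qre q (conjq q y * x) *+ 2) /\ T (normq q x) /\ T (normq q y).
    split; [|split]; rewrite /T -?conjq_add -?conjq_mul.
    - rewrite rmorphM /= conjqK; apply: mul_idealD; last by apply: mem_mul_ideal; [|exists x].
      by rewrite mulrC; apply: mem_mul_ideal; [|exists y].
    - by apply: mem_mul_ideal => //; exists x.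
    - by apply: mem_mul_ideal => //; exists y.
  have [reM _] := quadM q (ratK g^-1) (conjq q y * x).
  have [re_g im_g] := quad_ratK q g^-1.
  apply/andP; split; last first.
    (* The norm splits as (N(y) / g) (N(x) / g), and both norms lie in T. *)
    rewrite !normqM normq_ratK normq_cj expr2 mulrACA mulrC rpredM //.
      by rewrite mulrC; apply: gT; case: nmT.
    by rewrite mulrC; apply: gT; case: nmT.
  by rewrite reM re_g im_g mulr0 mul0r subr0 -mulrnAr mulrC; apply: gT.
apply/seteqP; split.
  apply: mul_ideal_le; first exact: order_submodule.
  by move=> x y Ix Jy; rewrite /order_set /= mulrC; apply: Jy.
(* As g is itself a sum of products x * conjq y, division by g writes 1 as a sum of terms x * (conjq
   y / g). *)
have one : mul_ideal I (inv_ideal I) 1.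
  rewrite -(mulfV gK0); move: Tg; rewrite /T.
  apply: (mul_ideal_sub (C := fun z => mul_ideal _ _ (z / _))).
  + by rewrite mul0r; apply: mul_ideal0.
  + by move=> u v; rewrite mulrDl; apply: mul_idealD.
  + by move=> x _ Ix [y Iy <-]; rewrite -mulrA; apply: mem_mul_ideal => //; apply: inv.
move=> c cO; rewrite -[c]mulr1.
by have [_ _] := mul_ideal_submodule (inv_ideal I) sI; apply.
Qed.
End InverseIdeal.

(** * Torsion modulo principal ideals *)

(** The bound on j serves [multiple_near_integer], where it bounds the multiplier uniformly;
    elsewhere only the collision matters. *)
Lemma pigeonhole (C : finType) (f : nat -> C) :
  exists i j, [/\ (i < j)%N, (j <= #|C|)%N & f i = f j].
Proof.
pose g (i : 'I_#|C|.+1) := f i.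
have /injectivePn[i [j ij gij]] : ~~ injectiveb g.
  apply/negP => /injectiveP/leq_card; rewrite card_ord ltnn //.
have [lt|lt|e] := ltngtP i j.
- by exists i, j; split=> //; rewrite -ltnS.
- by exists j, i; split=> //; rewrite -ltnS.
- by case/eqP: ij; apply: val_inj.
Qed.

Section OrderFiniteness.
Local Open Scope classical_set_scope.
Variables (K : fieldExtType rat) (q : quadratic K).
Local Notation OO := (@integral_over_Z K).
Local Notation D := (qD q).
Local Notation delta := (qdelta q).

Lemma delta_integral : delta \in OO.
Proof.
have [re_d im_d] : qre q delta = 0 /\ qim q delta = 1.
  by apply: quad_coords; rewrite rmorph0 rmorph1 mul1r add0r.
rewrite (integral_quad q) re_d mul0rn rpred0 /= /normq re_d im_d.
by rewrite expr0n expr1n mulr1 add0r rpred_nat.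
Qed.

(** Coordinates of integral elements have bounded denominators: 2 re x is a trace, and 2 D im x is
    up to sign the trace of x * delta. Their residues modulo M determine x modulo N. *)
Lemma order_mod_finite (N : nat) : (0 < N)%N ->
  exists (C : finType) (f : K -> C), forall x y, x \in OO -> y \in OO ->
    f x = f y -> exists2 z, z \in OO & x - y = N%:R * z.
Proof.
(* Dividing by 2 and by 2 D must leave a multiple of N: congruence modulo 2 D N gives differences D
   N k of real and N l of imaginary parts. *)
move=> N0; pose M := (2 * D * N)%N.
have M0 : (0 < M)%N by rewrite !muln_gt0 qD_gt0 N0.
pose r (a : rat) : 'I_M := Ordinal (ltn_pmod (absz (Num.floor a %% M)%Z) M0).
have rP a b : a \is a Num.int -> b \is a Num.int -> r a = r b ->
    exists k : int, a - b = M%:R * k%:~R.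
  move=> /intrP[x ->] /intrP[y ->] /(congr1 val) /=.
  rewrite !intrKfloor => e.
  have Mz : (M : int) != 0 by rewrite eqz_nat -lt0n.
  have small u : (absz (u %% M)%Z < M)%N.
    by rewrite -ltz_nat gez0_abs ?modz_ge0 // ltz_pmod.
  have : (x == y %[mod M])%Z.
    by rewrite -[(x %% M)%Z]gez0_abs ?modz_ge0 // -[(y %% M)%Z]gez0_abs ?modz_ge0 //;
       move: e; rewrite !modn_small // => ->.
  rewrite eqz_mod_dvd => /dvdzP[k kE]; exists k.
  by rewrite -intrB kE intrM mulrC.
exists ('I_M * 'I_M)%type, (fun x => (r (qre q x *+ 2), r (D%:R * (qim q x *+ 2)))).
have int2 x : x \in OO -> qre q x *+ 2 \is a Num.int /\ D%:R * (qim q x *+ 2) \is a Num.int.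
  move=> xO; split; first by move: xO; rewrite (integral_quad q) => /andP[].
  have : x * delta \in OO by rewrite rpredM ?delta_integral.
  have [re_d im_d] : qre q delta = 0 /\ qim q delta = 1.
    by apply: quad_coords; rewrite rmorph0 rmorph1 mul1r add0r.
  have [re_M _] := quadM q x delta.
  rewrite (integral_quad q) re_M re_d im_d mulr0 mulr1 sub0r mulNrn rpredN.
  by rewrite -mulrnAr => /andP[].
move=> x y xO yO /pair_equal_spec[e1 e2].
have [a1 a2] := int2 x xO; have [b1 b2] := int2 y yO.
have [k kE] := rP _ _ a1 b1 e1; have [l lE] := rP _ _ a2 b2 e2.
exists (D%:R * k%:~R + l%:~R * delta).
  by rewrite rpredD ?rpredM ?delta_integral ?rpred_nat ?rpred_int.
have [re_B im_B] := quadB q x y.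
rewrite [x - y](quadE q) re_B im_B.
have -> : qre q x - qre q y = D%:R * N%:R * k%:~R.
  by move: kE; rewrite /M !natrM; lra.
have D0 : D%:R != 0 :> rat by rewrite pnatr_eq0 -lt0n qD_gt0.
have -> : qim q x - qim q y = N%:R * l%:~R.
  by apply: (mulfI D0); move: lE; rewrite /M !natrM; lra.
by ring.
Qed.

(** Hurwitz's substitute for the Euclidean algorithm, with M independent of g: Dirichlet's box
    principle for the fractional parts of the coordinates of the multiples of g. *)
Lemma multiple_near_integer : exists2 M : nat, (0 < M)%N & forall g : K,
  exists t : nat, [/\ (0 < t <= M)%N & exists2 c, c \in OO & normq q (t%:R * g - c) < 1].
Proof.
(* In a box of side 1 / (D + 1) the form u^2 + D v^2 is at most (1 + D) / (D + 1)^2 = 1 / (D + 1) <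
   1. *)
pose C := ('I_D.+1 * 'I_D.+1)%type.
exists #|{: C}|; first by rewrite card_prod card_ord.
move=> g; pose fr (x : rat) := x - (Num.floor x)%:~R.
pose box x : 'I_D.+1 := inord (Num.truncn (D.+1%:R * fr x)).
have boxP x y : box x = box y -> `|fr x - fr y| < D.+1%:R^-1.
  have Q0 : 0 < D.+1%:R :> rat by rewrite ltr0n.
  have itv z : 0 <= D.+1%:R * fr z < D.+1%:R.
    have /andP[z0 z1] := floor_itv z; rewrite /fr mulr_ge0 ?subr_ge0 ?ler0n //=.
    by rewrite gtr_pMr // ltrBlDl -(intrD _ _ 1).
  have boxE z : (box z)%:R <= D.+1%:R * fr z < (box z)%:R + 1.
    have /andP[z0 z1] := itv z; have /andP[t0 t1] := truncn_itv z0.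
    rewrite /box inordK; first by rewrite t0 natr1.
    by rewrite -(ltr_nat rat) (le_lt_trans t0).
  move=> e; have := boxE x; rewrite e => /andP[x0 x1]; have /andP[y0 y1] := boxE y.
  rewrite -(ltr_pM2l Q0) mulfV ?gt_eqF // -{1}(gtr0_norm Q0) -normrM ltr_norml.
  by apply/andP; split; lra.
have [i [j [ij jC /pair_equal_spec[e1 e2]]]] := pigeonhole (fun t =>
  (box (t%:R * qre q g), box (t%:R * qim q g)) : C).
exists (j - i)%N; split; first by rewrite subn_gt0 ij (leq_trans (leq_subr _ _)).
pose a := Num.floor (j%:R * qre q g) - Num.floor (i%:R * qre q g).
pose b := Num.floor (j%:R * qim q g) - Num.floor (i%:R * qim q g).
exists (a%:~R + b%:~R * delta).
  by rewrite rpredD ?rpredM ?delta_integral ?rpred_int.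
have [re_c im_c] : qre q (a%:~R + b%:~R * delta) = a%:~R /\
    qim q (a%:~R + b%:~R * delta) = b%:~R.
  by apply: quad_coords; rewrite !rmorph_int.
have [re_n im_n] := quad_ratK q (j - i)%:R.
have [re_M im_M] := quadM q (j - i)%:R g.
have [re_B im_B] := quadB q ((j - i)%:R * g) (a%:~R + b%:~R * delta).
move: re_n im_n; rewrite rmorph_nat => re_n im_n.
rewrite /normq re_B im_B re_c im_c re_M im_M re_n im_n natrB ?(ltnW ij) //.
pose e : rat := D.+1%:R^-1; have e0 : 0 < e by rewrite invr_gt0 ltr0n.
have sq x y : box x = box y -> (fr y - fr x) ^+ 2 <= e ^+ 2.
  move=> /esym/boxP/ltW h; rewrite -real_normK ?num_real //.
  by rewrite lerXn2r ?nnegrE // ltW.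
have h1 := sq _ _ e1; have h2 := sq _ _ e2.
have De : (D%:R + 1) * e = 1 by rewrite natr1 mulfV ?pnatr_eq0.
have D1 : 1 <= D%:R :> rat by rewrite ler1n qD_gt0.
move: h1 h2; rewrite /a /b /fr !intrB.
set A := (X in X ^+ 2 <= _); set B := (X in _ -> X ^+ 2 <= _ -> _) => h1 h2.
have -> : (j%:R - i%:R) * qre q g - D%:R * 0 * qim q g -
  ((Num.floor (j%:R * qre q g))%:~R - (Num.floor (i%:R * qre q g))%:~R) = A.
  by rewrite /A; ring.
have -> : (j%:R - i%:R) * qim q g + 0 * qre q g -
  ((Num.floor (j%:R * qim q g))%:~R - (Num.floor (i%:R * qim q g))%:~R) = B.
  by rewrite /B; ring.
have h3 : D%:R * B ^+ 2 <= D%:R * e ^+ 2 by rewrite ler_wpM2l ?ler0n.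
have h4 : (D%:R + 1) * e ^+ 2 = e by rewrite expr2 mulrA De mul1r.
have h5 : e < 1 by nra.
by lra.
Qed.
End OrderFiniteness.

Section IdealClassTorsion.
Local Open Scope classical_set_scope.
Variables (K : fieldExtType rat) (q : quadratic K).
Local Notation OO := (@integral_over_Z K).

Lemma normq_integral_nat z : z \in OO -> exists n : nat, normq q z = n%:R.
Proof.
rewrite (integral_quad q) => /andP[_ /intrP[k kE]].
have : 0 <= k by rewrite -(ler0z rat) -kE normq_ge0.
by case: k kE => // n nE _; exists n.
Qed.

(** The scaling factor is M! / b with b in I nonzero of least norm. For x in I some t <= M brings t
    x / b within norm less than 1 of an integral c; then t x - c b lies in I and is smaller than b,
    so it is 0, and t divides M!. N = M! is the same for all I. *)
Lemma fractional_scaled_large : exists2 N : nat, (0 < N)%N &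
  forall I : set K, fractional_ideal I -> exists2 a : K, a != 0 &
    [/\ submodule (mul_ideal (principal_ideal a) I),
        mul_ideal (principal_ideal a) I N%:R &
        mul_ideal (principal_ideal a) I `<=` @order_set K].
Proof.
have [M M0 hM] := multiple_near_integer q; exists M`!; first exact: fact_gt0.
move=> I fI; have [d [dO d0 dI]] := fractional_denom fI.
have sI := fractional_submodule fI; have [_ _ IM] := sI.
have [[x0 Ix0 x00] _ _ _] := fI.
(* Minimizing the norm of d x instead of x keeps the values in the natural numbers. *)
pose P (k : nat) := `[< exists x, [/\ I x, x != 0 & normq q (d * x) = k%:R] >].
have exP : exists k, P k.
  have [k kE] := normq_integral_nat (dI _ Ix0).
  by exists k; apply/asboolP; exists x0.
have [k /asboolP[b [Ib b0 kE]] kmin] := ex_minnP exP.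
exists (M`!%:R / b); first by rewrite mulf_neq0 ?invr_eq0 // (natK_eq0 K) -lt0n fact_gt0.
split; first by apply/mul_ideal_submodule/principal_submodule.
  by apply/mul_principal => //; exists b => //; rewrite divfK.
move=> _ /mul_principal[] // x Ix ->; rewrite /order_set /=.
have [t [/andP[t0 tM] [c cO ltc]]] := hM (x / b).
have cE : t%:R * (x / b) = c.
  apply/eqP; rewrite -subr_eq0; apply/negPn/negP => nz.
  pose y := t%:R * x - c * b.
  have yE : d * y = (d * b) * (t%:R * (x / b) - c) by rewrite /y; field.
  have Iy : I y.
    by apply: submoduleB => //; apply: IM => //; apply: rpred_nat.
  have [l lE] := normq_integral_nat (dI _ Iy).
  have : (k <= l)%N.
    apply: kmin; apply/asboolP; exists y; split=> //.
    apply: contraNneq nz => y0; have : d * y == 0 by rewrite y0 mulr0.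
    by rewrite yE !mulf_eq0 (negPf d0) (negPf b0).
  rewrite leqNgt -(ltr_nat rat) -lE -kE yE normqM gtr_pMr ?ltc //.
  by apply: normq_gt0; rewrite mulf_neq0.
have /dvdnP[s ->] : (t %| M`!)%N by rewrite dvdn_fact // t0 tM.
have -> : (s * t)%:R / b * x = s%:R * (t%:R * (x / b)) by rewrite natrM; ring.
by rewrite cE rpredM ?rpred_nat.
Qed.

Definition ideal_exp (I : set K) k := iter k (mul_ideal I) (@order_set K).

Lemma fractional_exp I k : fractional_ideal I -> fractional_ideal (ideal_exp I k).
Proof.
by move=> fI; elim: k => [|k IH]; [apply: fractional_order|apply: fractional_mul].
Qed.

Lemma ideal_expD I i j : fractional_ideal I ->
  ideal_exp I (i + j) = mul_ideal (ideal_exp I i) (ideal_exp I j).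
Proof.
move=> fI; elim: i => [|i IH].
  by rewrite mul_order_ideal //; apply/fractional_submodule/fractional_exp.
by rewrite addSn /= -/(ideal_exp _ _) IH mul_idealA.
Qed.

Lemma principal_exp (a : K) k : ideal_exp (principal_ideal a) k = principal_ideal (a ^+ k).
Proof.
elim: k => [|k IH]; first by rewrite expr0 principal1.
by rewrite /= -/(ideal_exp _ _) IH principal_mul exprS.
Qed.

Lemma mul_inv_cancel (I J : set K) : fractional_ideal I -> submodule J ->
  mul_ideal (inv_ideal I) (mul_ideal I J) = J.
Proof.
move=> fI sJ; rewrite mul_idealA [mul_ideal (inv_ideal _) _]mul_idealC.
by rewrite (mul_ideal_inv q fI) mul_order_ideal.
Qed.

(** The scaled powers a_i I^i lie between N O and O, so only finitely many occur; two of them agree,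
    and I^i is cancelled. *)
Lemma ideal_exp_principal (I : set K) : fractional_ideal I ->
  exists k a, [/\ (0 < k)%N, a != 0 & ideal_exp I k = principal_ideal a].
Proof.
move=> fI; have [N N0 scale] := fractional_scaled_large.
have [C [f fP]] := order_mod_finite q N0.
have /choice[a aP] : forall i, exists a : K, a != 0 /\
    [/\ submodule (mul_ideal (principal_ideal a) (ideal_exp I i)),
        mul_ideal (principal_ideal a) (ideal_exp I i) N%:R &
        mul_ideal (principal_ideal a) (ideal_exp I i) `<=` @order_set K].
  by move=> i; have [a a0 aP] := scale _ (fractional_exp i fI); exists a.
pose J i := mul_ideal (principal_ideal (a i)) (ideal_exp I i).
(* Since [J i] contains N O, it is determined by the residue classes modulo N that it meets. *)
pose code i : {set C} := [set c | `[< exists2 x, J i x & f x = c >]]%SET.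
have codeP i j : code i = code j -> J i `<=` J j.
  move=> ij x Jx; have [_ [_ _ JO]] := aP i; have [_ [sJ JN JO']] := aP j.
  have : f x \in code i by rewrite inE; apply/asboolP; exists x.
  rewrite ij inE => /asboolP[y Jy yx].
  have [z zO zE] := fP x y (JO _ Jx) (JO' _ Jy) (esym yx).
  rewrite -(subrK y x) zE; have [_ JD JM] := sJ; apply: JD => //.
  by rewrite mulrC; apply: JM.
have [i [j [ij _ cij]]] := pigeonhole code.
have Jij : J i = J j by apply/seteqP; split; apply: codeP.
have [ai0 _] := aP i; have [aj0 _] := aP j.
exists (j - i)%N, (a i / a j); split.
- by rewrite subn_gt0.
- by rewrite mulf_neq0 ?invr_eq0.
have fi := fractional_exp i fI; have fd := fractional_exp (j - i) fI.
move: Jij; rewrite /J -{2}(subnKC (ltnW ij)) ideal_expD //.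
move=> /(congr1 (mul_ideal (principal_ideal (a j)^-1))).
rewrite !mul_idealA !principal_mul mulVf // principal1 -mul_idealA mul_order_ideal; last first.
  by apply/mul_ideal_submodule/fractional_submodule.
rewrite mul_idealC => /(congr1 (mul_ideal (inv_ideal (ideal_exp I i)))).
rewrite !mul_inv_cancel //; [|exact: fractional_submodule|exact: principal_submodule].
by move=> <-; rewrite mulrC.
Qed.

Lemma integral_ideal_exp I k : integral_ideal I -> integral_ideal (ideal_exp I k).
Proof.
move=> [fI IO]; split; first exact: fractional_exp.
elim: k => [|k IH] //; suff: ideal_exp I k.+1 `<=` @order_set K by [].
apply: mul_ideal_le; first exact: order_submodule.
by move=> x y /IO xO /IH yO; apply: rpredM.
Qed.


Lemma coprime_mul (A B m : set K) : submodule m -> integral_ideal A ->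
  coprime_ideals A m -> coprime_ideals B m -> coprime_ideals (mul_ideal A B) m.
Proof.
move=> [_ mD mM] [_ AO] [x [y [Ax my e]]] [u [v [Bu mv e']]].
exists (x * u), (x * v + y); split; first exact: mem_mul_ideal.
  by apply: mD => //; apply: mM => //; apply: AO.
by rewrite addrA -mulrDr e' mulr1.
Qed.

Lemma coprime_order_ideal (m : set K) : submodule m -> coprime_ideals (@order_set K) m.
Proof. by case=> m0 _ _; exists 1, 0; rewrite addr0; split=> //; apply: rpred1. Qed.

Lemma coprime_exp (A m : set K) k : submodule m -> integral_ideal A ->
  coprime_ideals A m -> coprime_ideals (ideal_exp A k) m.
Proof.
move=> sm iA cA; elim: k => [|k IH]; first exact: coprime_order_ideal.
exact: coprime_mul.
Qed.

(** Let N be the norm of a nonzero element of m, so that N is in m. Two powers of g agree modulo N,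
    and coprimality of g^i to m cancels g^i from g^i (g^(j - i) - 1). *)
Lemma coprime_power_congr1 (m : set K) (g : K) : integral_ideal m -> g != 0 ->
  g \in OO -> coprime_ideals (principal_ideal g) m ->
  exists2 k : nat, (0 < k)%N & m (g ^+ k - 1).
Proof.
move=> [fm mO] g0 gO cg; have sm := fractional_submodule fm.
have [m0 mD mM] := sm.
have [[x mx x0] _ _ _] := fm.
have [N NE] := normq_integral_nat (mO _ mx).
have N0 : (0 < N)%N by rewrite -(ltr_nat rat) -NE normq_gt0.
have mN : m N%:R.
  rewrite -(rmorph_nat (@ratK K)) -NE /= -conjq_mul mulrC.
  by apply: mM => //; apply: integral_conjq; apply: mO.
have [C [f fP]] := order_mod_finite q N0.
have [i [j [ij _ eij]]] := pigeonhole (fun i => f (g ^+ i)).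
have [z zO zE] := fP _ _ (rpredX i gO) (rpredX j gO) eij.
exists (j - i)%N; first by rewrite subn_gt0.
have [y [w [+ mw e]]] : coprime_ideals (principal_ideal (g ^+ i)) m.
  rewrite -principal_exp; apply: coprime_exp => //; split.
    by apply: fractional_principal => //; exists 1; rewrite ?rpred1 ?oner_neq0 ?mul1r.
  by move=> u /principalP[c cO ->]; apply: rpredM.
case/principalP=> c cO yE; set h := g ^+ (j - i) - 1.
have hO : h \in OO by rewrite rpredB ?rpredX ?rpred1.
have -> : h = (- (c * z)) * N%:R + h * w.
  have {1}-> : h = h * y + h * w by rewrite -mulrDr e mulr1.
  rewrite yE; congr (_ + _).
  have -> : h * (g ^+ i * c) = - (c * (g ^+ i - g ^+ j)).
    have -> : g ^+ j = g ^+ (j - i) * g ^+ i by rewrite -exprD subnK // ltnW.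
    by rewrite /h; ring.
  by rewrite zE; ring.
by apply: mD; apply: mM => //; rewrite rpredN rpredM.
Qed.

(** The generator is kept integral, because its image will be a power of psi(p). *)
Lemma coprime_ideal_exp_P1 (m I : set K) : integral_ideal m ->
  integral_ideal I -> coprime_ideals I m ->
  exists k g, [/\ (0 < k)%N, g \in OO, congr1_mod m g & ideal_exp I k = principal_ideal g].
Proof.
move=> im iI cI; have sm := fractional_submodule im.1.
have [k [g [k0 g0 gE]]] := ideal_exp_principal iI.1.
have gO : g \in OO.
  by apply: (integral_ideal_exp k iI).2; rewrite gE; apply: mem_principal.
have [|t t0 mt] := coprime_power_congr1 im g0 gO.
  by rewrite -gE; apply: coprime_exp.
exists (k * t)%N, (g ^+ t); split; rewrite ?muln_gt0 ?k0 ?rpredX //.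
  split; first by rewrite expf_neq0.
  have gtO : g ^+ t \in OO by rewrite rpredX.
  exists (Sub (g ^+ t) gtO : integers K), 1; rewrite oner_neq0; split=> //=.
    by rewrite principal1; apply: coprime_order_ideal.
  by rewrite divr1.
rewrite -principal_exp -gE; elim: (t) => [|s IH]; first by rewrite muln0.
by rewrite mulnS ideal_expD ?IH //; exact: iI.1.
Qed.
End IdealClassTorsion.

(** * Extension of homomorphisms by Zorn *)

Section Extension.
Local Open Scope classical_set_scope.

(** [Zorn_bigcup] also demands the union of the empty chain, so the empty set is adjoined to Q; as
    [B0] is nonempty, the maximal set is not the adjoined one. *)
Lemma zorn_above (T : Type) (Q : set (set T)) (B0 : set T) :
  Q B0 -> (forall X, Q X -> X !=set0) ->
  (forall F : set (set T), F !=set0 -> F `<=` Q ->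
     (forall X Y, F X -> F Y -> X `<=` Y \/ Y `<=` X) ->
     Q (\bigcup_(X in F) X)) ->
  exists A, Q A /\ forall B, Q B -> A `<=` B -> B `<=` A.
Proof.
move=> QB0 Qn Qcup.
have [F FP Ftot|A [PA maxA]] := @Zorn_bigcup T [set X | X = set0 \/ Q X].
  have [[X [FX QX]]|noX] := pselect (exists X, F X /\ Q X); last first.
    left; rewrite -subset0 => x [X FX Xx]; case: (FP X FX) => [X0|QX].
      by rewrite -X0.
    by case: noX; exists X.
  right; have -> : \bigcup_(X in F) X = \bigcup_(X in F `&` Q) X.
    apply/seteqP; split=> x [Y].
      by move=> FY Yx; case: (FP Y FY) => [Y0|QY]; [rewrite Y0 in Yx|exists Y].
    by move=> [FY _] Yx; exists Y.
  apply: Qcup; [by exists X|by move=> Y []|].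
  by move=> Y Z [FY _] [FZ _]; apply: Ftot.
have QA : Q A.
  case: PA => // A0; case: (maxA B0); last by right.
  split; rewrite A0; first exact: sub0set.
  by have [x Bx] := Qn _ QB0 => /(_ _ Bx).
exists A; split=> // B QB AB; apply: contrapT => BA.
by apply: (maxA B); [split|right].
Qed.

(** [good] is a group extension of V, [G0] the graph of a section over a subgroup, and the
    root-lifting hypothesis stands for divisibility of the kernel. With graphs, unions of chains are
    immediate and single-valuedness concerns only the fibre over 0. *)
Lemma hom_extension (V : zmodType) (C : fieldType)
    (good : V -> C -> Prop) (G0 : V -> C -> Prop) :
  (forall v x, good v x -> x != 0) ->
  (forall v w x y, good v x -> good w y -> good (v + w) (x * y)) ->
  (forall v x, good v x -> good (- v) x^-1) ->
  (forall v, exists x, good v x) ->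
  (forall v n s, (0 < n)%N -> good (v *+ n) s -> exists2 x, good v x & x ^+ n = s) ->
  (forall v x, G0 v x -> good v x) ->
  G0 0 1 ->
  (forall v w x y, G0 v x -> G0 w y -> G0 (v + w) (x * y)) ->
  (forall v x, G0 v x -> G0 (- v) x^-1) ->
  (forall x, G0 0 x -> x = 1) ->
  exists psi : V -> C, [/\ forall v, good v (psi v),
    forall v w, psi (v + w) = psi v * psi w & forall v x, G0 v x -> psi v = x].
Proof.
move=> good0 goodM goodV good_ex lift G0good G01 G0M G0V G0inj.
pose Q (X : set (V * C)) := [/\ forall v x, G0 v x -> X (v, x),
  forall v x, X (v, x) -> good v x,
  forall v w x y, X (v, x) -> X (w, y) -> X (v + w, x * y),
  forall v x, X (v, x) -> X (- v, x^-1) & forall x, X (0, x) -> x = 1].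
have [||F [X0 FX0] FQ Ftot|A [[G0A Agood AM AV A1] maxA]] :=
    @zorn_above (V * C)%type Q [set p | G0 p.1 p.2].
- by split.
- by move=> X [+ _ _ _ _] => /(_ _ _ G01); exists (0, 1).
- split.
  + by move=> v x Gx; exists X0 => //; have [+ _ _ _ _] := FQ _ FX0; apply.
  + by move=> v x [X FX Xx]; have [_ + _ _ _] := FQ _ FX; apply.
  + move=> v w x y [X FX Xx] [Y FY Yy].
    have [XY|YX] := Ftot _ _ FX FY.
    * by exists Y => //; have [_ _ + _ _] := FQ _ FY; apply=> //; apply: XY.
    * by exists X => //; have [_ _ + _ _] := FQ _ FX; apply=> //; apply: YX.
  + by move=> v x [X FX Xx]; exists X => //; have [_ _ _ + _] := FQ _ FX; apply.
  + by move=> x [X FX Xx]; have [_ _ _ _ +] := FQ _ FX; apply.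
have A01 : A (0, 1) by apply: G0A.
have AX v x (k : int) : A (v, x) -> A (v *~ k, x ^ k).
  move=> Ax; have An n : A (v *+ n, x ^+ n).
    by elim: n => [|n IH]; rewrite ?mulr0n ?expr0 // mulrS exprS; apply: AM.
  by case: k => n; [exact: An|exact: (AV _ _ (An n.+1))].
have goodX v x (k : int) : good v x -> good (v *~ k) (x ^ k).
  have g01 : good 0 1 by apply: G0good.
  move=> Ax; have An n : good (v *+ n) (x ^+ n).
    by elim: n => [|n IH]; rewrite ?mulr0n ?expr0 // mulrS exprS; apply: goodM.
  by case: k => n; [exact: An|exact: (goodV _ _ (An n.+1))].
have total v : exists x, A (v, x).
  pose dom w := exists x, A (w, x).
  (* [n] generates the group of all k with k v in the domain of A. It is 0 if only k = 0 occurs, and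
     then any good x will do. *)
  have [n [x [gx Anx ndvd]]] : exists (n : nat) x, [/\ good v x, A (v *+ n, x ^+ n) &
      forall k : int, dom (v *~ k) -> exists l : int, k = l * n].
    pose P n := `[< (0 < n)%N /\ dom (v *+ n) >].
    have [exP|noP] := pselect (exists n, P n); last first.
      have [x gx] := good_ex v; exists 0%N, x; split=> // k [y Ay].
      exists 0; rewrite mul0r; apply/eqP; rewrite -absz_eq0; apply/negPn/negP => k0.
      apply: noP; exists (absz k); apply/asboolP; split; first by rewrite lt0n.
      case: k Ay {k0} => n Ay; first by exists y.
      by exists y^-1; rewrite -[v *+ _]opprK; apply: (AV _ _ Ay).
    have [n /asboolP[n0 [s As]] nmin] := ex_minnP exP.
    have [x gx xs] := lift _ _ _ n0 (Agood _ _ As).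
    exists n, x; split; rewrite ?xs // => k [y Ay].
    exists (k %/ n)%Z.
    have nz : (n : int) != 0 by rewrite eqz_nat -lt0n.
    rewrite {1}(divz_eq k n); have [r0|r0] := eqVneq (k %% n)%Z 0.
      by rewrite r0 addr0.
    suff: (n <= absz (k %% n)%Z)%N.
      by rewrite leqNgt -ltz_nat gez0_abs ?modz_ge0 // ltz_pmod.
    apply: nmin; apply/asboolP; split; first by rewrite lt0n absz_eq0.
    have -> : v *+ absz (k %% n)%Z = v *~ k + - (v *+ n *~ (k %/ n)%Z).
      rewrite -[v *+ absz _]/(v *~ Posz _) gez0_abs ?modz_ge0 //.
      by rewrite -[v *+ n]/(v *~ Posz n) -mulrzA -mulrNz -mulrzDr /modz [Posz n * _]mulrC.
    by exists (y * (s ^ (k %/ n)%Z)^-1); apply: AM => //; apply/AV/AX.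
  pose B : set (V * C) := [set p | exists w y (k : int),
     [/\ A (w, y), p.1 = w + v *~ k & p.2 = y * x ^ k]].
  have QB : Q B.
    split.
    - move=> w y Gy; exists w, y, 0; rewrite mulr0z addr0 expr0z mulr1.
      by split=> //; apply: G0A.
    - by move=> _ _ [w [y [k [/= Ay -> ->]]]]; apply: goodM; [apply: Agood|apply: goodX].
    - move=> _ _ _ _ [w [y [k [/= Ay -> ->]]]] [w' [y' [k' [/= Ay' -> ->]]]].
      exists (w + w'), (y * y'), (k + k'); split; first exact: AM.
        by rewrite mulrzDr addrACA.
      by rewrite expfzDr ?(good0 _ _ gx) // mulrACA.
    - move=> _ _ [w [y [k [/= Ay -> ->]]]]; exists (- w), y^-1, (- k).
      by rewrite opprD mulrNz invfM invr_expz; split=> //; apply: AV.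
    (* If w + k v = 0, then k v is in the domain, so k = l n and x^k = (x^n)^l is the value that A
       already takes at k v. *)
    - move=> _ [w [y [k [/= Ay w0 ->]]]].
      have vk : v *~ k = - w by apply/eqP; rewrite -addr_eq0 addrC -w0.
      have [l kE] : exists l : int, k = l * n.
        by apply: ndvd; rewrite vk; exists y^-1; apply: AV.
      have := AX _ _ l Anx; rewrite -[v *+ n]/(v *~ Posz n) -mulrzA [n%:Z * l]mulrC -kE.
      move=> /(AM _ _ _ _ Ay); rewrite -w0 => /A1.
      by rewrite -[x ^+ n]/(x ^ Posz n) exprz_exp [Posz n * l]mulrC -kE.
  exists x; apply: (maxA B QB).
    by move=> [w y] Ay; exists w, y, 0; rewrite mulr0z addr0 expr0z mulr1.
  by exists 0, 1, 1; rewrite mulr1z add0r expr1z mul1r.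
have [psi psiA] := choice total.
have Afun v x y : A (v, x) -> A (v, y) -> x = y.
  move=> Ax Ay; have y0 := good0 _ _ (Agood _ _ Ay).
  have := AM _ _ _ _ Ax (AV _ _ Ay); rewrite subrr => /A1/(canRL (mulfVK y0)).
  by rewrite mul1r.
exists psi; split=> [v|v w|v x Gx].
- exact: Agood.
- by apply: (Afun (v + w)) => //; apply: AM.
- by apply: (Afun v) => //; apply: G0A.
Qed.
End Extension.

(** * Algebraic integers and maximal ideals of Zbar *)

Lemma AintP (x : algC) : reflect (integralOver (intr : int -> algC) x) (x \in Aint).
Proof.
apply: (iffP idP) => [xA|[p mon_p px]]; last first.
  by apply: root_monic_Aint px _ _; [exact: monic_map|];
     apply/polyOverP => i; rewrite coef_map /= intr_int.
have [p pE] := floorpP xA; exists p; last by rewrite -pE root_minCpoly.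
have := minCpoly_monic x; rewrite pE => /monicP/eqP.
rewrite lead_coef_map_inj ?monicE // => [/eqP|]; last exact: intr_inj.
by rewrite -[1]/(1%:~R) => /intr_inj ->.
Qed.

Lemma Aint_root (n : nat) (y : algC) : (0 < n)%N -> y ^+ n \in Aint -> y \in Aint.
Proof.
move=> n0 yA; apply/AintP; apply: (@integral_root_monic _ _ _ y ('X^n - (y ^+ n)%:P)).
- exact: monicXnsubC.
- by apply/rootP; rewrite !hornerE subrr.
apply/integral_poly => i; rewrite coefB coefXn coefC; apply: integral_sub.
  exact: integral_nat.
by case: eqP => _; [apply/AintP|apply: integral0].
Qed.

Lemma iota_integral (K : fieldType) (iota : {rmorphism K -> algC}) x :
  (x \in @integral_over_Z K) = (iota x \in Aint).
Proof.
have mapE (p : {poly int}) : map_poly intr p = map_poly iota (map_poly intr p).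
  by rewrite -map_poly_comp; apply: eq_map_poly => k /=; rewrite rmorph_int.
apply/asboolP/AintP => -[p mon_p px]; exists p => //; first by rewrite mapE fmorph_root.
by move: px; rewrite mapE fmorph_root.
Qed.

Section MaximalIdeal.
Local Open Scope classical_set_scope.

Lemma exists_maximal_ideal (R : comNzRingType) (S : set R) :
  S 0 -> (forall x y, S x -> S y -> S (x + y)) ->
  (forall a x, S x -> S (a * x)) -> ~ S 1 ->
  exists L : idealr R, [/\ maximal_ideal L, forall x, S x -> x \in L
    & forall x y, x * y \in L -> (x \in L) || (y \in L)].
Proof.
move=> S0 SD SM S1.
pose Q (X : set R) := [/\ S `<=` X, forall x y, X x -> X y -> X (x + y),
  forall a x, X x -> X (a * x) & ~ X 1].
have [||F [X0 FX0] FQ Ftot|A [[SA AD AM A1] maxA]] := @zorn_above R Q S.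
- by split.
- by move=> X [SX _ _ _]; exists 0; apply: SX.
- split.
  + by move=> x Sx; exists X0 => //; have [+ _ _ _] := FQ _ FX0; apply.
  + move=> x y [X FX Xx] [Y FY Yy]; have [XY|YX] := Ftot _ _ FX FY.
    * by exists Y => //; have [_ + _ _] := FQ _ FY; apply=> //; apply: XY.
    * by exists X => //; have [_ + _ _] := FQ _ FX; apply=> //; apply: YX.
  + by move=> a x [X FX Xx]; exists X => //; have [_ _ + _] := FQ _ FX; apply.
  + by move=> [X FX X1]; have [_ _ _] := FQ _ FX; apply.
pose L x := `[< A x >].
have Lideal : idealr_closed L.
  split; [exact/asboolP/SA|exact/asboolP|].
  by move=> a u v /asboolP Au /asboolP Av; apply/asboolP; apply: AD => //; apply: AM.
pose LI : idealr R := HB.pack L (isIdealr.Build R L Lideal).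
have LE x : (x \in LI) = `[< A x >] by [].
have A0 : A 0 by apply: SA.
exists LI; split.
- move=> J LJ x xJ; rewrite LE; apply/asboolP.
  apply: (maxA [set y | y \in J]) => //= [|y Ay]; last by apply: LJ; rewrite LE; apply/asboolP.
  split=> [y Sy|y z|a y|] /=.
  + by apply: LJ; rewrite LE; apply/asboolP/SA.
  + exact: rpredD.
  + exact: idealMr.
  + by rewrite idealr1.
- by move=> x Sx; rewrite LE; apply/asboolP/SA.
- move=> x y; rewrite !LE => /asboolP Axy; apply/orP.
  have [Ax|nAx] := pselect (A x); [by left; apply/asboolP|right; apply/asboolP].
  (* For x outside A, maximality puts 1 in A + (x); multiplying by y gives y in A. *)
  pose B := [set z | exists u a, A u /\ z = u + a * x].
  have [[u [a [Au e]]]|nB1] := pselect (B 1).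
    rewrite -[y]mul1r e mulrDl mulrC -mulrA; apply: AD; [exact: AM|exact: AM].
  case: nAx; apply: (maxA B); [split=> //|move=> u Au|].
  + by move=> z Sz; exists z, 0; rewrite mul0r addr0; split=> //; apply: SA.
  + move=> _ _ [u [a [Au ->]]] [v [b [Av ->]]]; exists (u + v), (a + b).
    by rewrite mulrDl addrACA; split=> //; apply: AD.
  + move=> c _ [u [a [Au ->]]]; exists (c * u), (c * a).
    by rewrite mulrDr mulrA; split=> //; apply: AM.
  + by exists u, 0; rewrite mul0r addr0.
  + by exists 0, 1; rewrite mul1r add0r.
Qed.
End MaximalIdeal.

(* Every element of F is P(a) for a generator a of the multiplicative group and
   some integral polynomial P.  A monic integral polynomial g of least degree
   with g(a) = 0 is the minimal polynomial of a modulo ell, hence P(a) |-> P(t)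
   is well defined for every root t of g in E. *)
Lemma finField_embedding (F : finFieldType) (E : comNzRingType) (ell : nat) :
  prime ell -> ell%:R = 0 :> F -> ell%:R = 0 :> E ->
  (forall g : {poly int}, g \is monic -> (1 < size g)%N ->
     exists t : E, root (map_poly intr g) t) ->
  inhabited {rmorphism F -> E}.
Proof.
move=> ell_pr ellF ellE rootE.
have /cyclicP[u uE] := field_unit_group_cyclic [set: {unit F}]%G.
pose a : F := val u.
pose evF (P : {poly int}) : F := (map_poly intr P).[a].
have evFB P Q : evF (P - Q) = evF P - evF Q by rewrite /evF rmorphB /= !hornerE.
have evFD P Q : evF (P + Q) = evF P + evF Q by rewrite /evF rmorphD /= !hornerE.
have evFM P Q : evF (P * Q) = evF P * evF Q by rewrite /evF rmorphM /= !hornerE.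
have evFXn k : evF 'X^k = a ^+ k by rewrite /evF map_polyXn hornerXn.
have evFC c : evF c%:P = c%:~R by rewrite /evF map_polyC hornerC.
have surj y : exists P, evF P = y.
  have [->|y0] := eqVneq y 0; first by exists 0; rewrite /evF rmorph0 horner0.
  have yU : y \is a GRing.unit by rewrite unitfE.
  have : FinRing.unit F yU \in <[u]>%g by rewrite -uE inE.
  case/cycleP=> k /(congr1 val) /= yk; exists 'X^k.
  by rewrite evFXn yk FinRing.val_unitX.
pose Pg k := `[< exists g : {poly int}, [/\ g \is monic, evF g = 0 & size g = k] >].
have exPg : exists k, Pg k.
  (* Some monic integral polynomial vanishes at a because a has finite order. *)
  pose g : {poly int} := 'X^#[u]%g - 1.
  exists (size g); apply/asboolP; exists g; split=> //.
    by rewrite monicXnsubC ?order_gt0.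
  rewrite evFB evFXn -[1]/(1%:P) evFC -FinRing.val_unitX.
  by rewrite expg_order /= subrr.
have [k /asboolP[g [mon_g ga gk]] kmin] := ex_minnP exPg.
have g1 : (1 < size g)%N.
  rewrite ltnNge; apply/negP => /size1_polyC gE; have := oner_neq0 F.
  have g01 : g`_0 = 1 by move/monicP: mon_g; rewrite gE lead_coefC coefC.
  by case/eqP; move: ga; rewrite gE g01 evFC.
have [t /rootP gt] := rootE g mon_g g1.
pose evE (P : {poly int}) : E := (map_poly intr P).[t].
have evEB P Q : evE (P - Q) = evE P - evE Q by rewrite /evE rmorphB /= !hornerE.
have evED P Q : evE (P + Q) = evE P + evE Q by rewrite /evE rmorphD /= !hornerE.
have evEM P Q : evE (P * Q) = evE P * evE Q by rewrite /evE rmorphM /= !hornerE.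
have evEC c : evE c%:P = c%:~R by rewrite /evE map_polyC hornerC.
have small s : forall P : {poly int},
    (size P <= s)%N -> (size P < size g)%N -> evF P = 0 -> evE P = 0.
  elim: s => [P|s IH P sP ltP Pa].
    by rewrite leqn0 size_poly_eq0 => /eqP -> _ _; rewrite /evE rmorph0 horner0.
  have [->|P0] := eqVneq P 0; first by rewrite /evE rmorph0 horner0.
  pose c := lead_coef P; pose d := (size P).-1.
  have sd : size P = d.+1 by rewrite /d prednK // size_poly_gt0.
  have [/dvdzP[w cw]|ndvd] := boolP (ell %| c)%Z.
    have ring0 (R : nzRingType) : ell%:R = 0 :> R -> c%:~R = 0 :> R.
      by move=> l0; rewrite cw intrM (l0 : (ell : int)%:~R = 0 :> R) mulr0.
    pose P' := P - c%:P * 'X^d.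
    have sP' : (size P' <= d)%N.
      apply/leq_sizeP => i; rewrite leq_eqVlt /P' coefB coefCM coefXn => /orP[/eqP <-|di].
        by rewrite eqxx mulr1 subrr.
      by rewrite gtn_eqF // mulr0 subr0 nth_default // sd.
    have -> : P = P' + c%:P * 'X^d by rewrite subrK.
    rewrite evED evEM evEC ring0 // mul0r addr0.
    apply: IH; first by rewrite -ltnS (leq_trans _ sP) // sd ltnS.
      by apply: leq_ltn_trans ltP; rewrite sd; apply: leqW.
    by rewrite /P' evFB evFM evFC ring0 // mul0r subr0.
  have /coprimezP[[x y] /= xy] : coprimez c ell.
    by rewrite coprimezE coprime_sym prime_coprime.
  pose S := x%:P * P + (y * ell)%:P * 'X^d.
  have Sd : S`_d = 1 by rewrite coefD !coefCM coefXn eqxx mulr1.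
  have sS : size S = d.+1.
    apply/eqP; rewrite eqn_leq; apply/andP; split.
      apply/leq_sizeP => i di; rewrite coefD !coefCM coefXn gtn_eqF // mulr0 addr0.
      by rewrite nth_default ?mulr0 // sd.
    by rewrite ltnNge; apply/negP => /leq_sizeP/(_ d (leqnn _)); rewrite Sd.
  suff: (k <= size S)%N by rewrite leqNgt sS -sd -gk ltP.
  apply: kmin; apply/asboolP; exists S; split=> //.
    by rewrite monicE lead_coefE sS Sd.
  by rewrite evFD !evFM Pa mulr0 add0r evFC intrM (ellF : (ell : int)%:~R = 0 :> F) mulr0 mul0r.
have key P : evF P = 0 -> evE P = 0.
  move=> Pa; have PE := Pdiv.RingMonic.rdivp_eq mon_g P.
  have gt0 : evE g = 0 by [].
  rewrite PE evED evEM gt0 mulr0 add0r; apply: (small _ _ (leqnn _)).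
    by rewrite Pdiv.Ring.ltn_rmodp monic_neq0.
  by move: Pa; rewrite {1}PE evFD evFM ga mulr0 add0r.
have [P PE] := choice surj.
pose j y := evE (P y).
have jE y Q : evF Q = y -> j y = evE Q.
  move=> Qy; apply/eqP; rewrite -subr_eq0 -evEB; apply/eqP; apply: key.
  by rewrite evFB PE Qy subrr.
have jB : zmod_morphism j.
  by move=> x y; rewrite (jE (x - y) (P x - P y)) ?evEB // evFB !PE.
have jM : monoid_morphism j.
  split=> [|x y]; first by rewrite (jE 1 1%:P) ?evEC ?evFC.
  by rewrite (jE (x * y) (P x * P y)) ?evEM // evFM !PE.
constructor.
pose j' : {rmorphism F -> E} := HB.pack j (GRing.isZmodMorphism.Build F E j jB)
   (GRing.isMonoidMorphism.Build F E j jM).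
exact: j'.
Qed.

Definition zval : {rmorphism Zbar -> algC} := val.

Definition residue (L : idealr Zbar) : {rmorphism Zbar -> {ideal_quot L}} :=
  \pi_({ideal_quot L}).

(** * Reduction of L-units modulo L *)

Section Residue.
Variables (L : idealr Zbar).
Local Notation E := {ideal_quot L}.
Local Notation piL := (residue L).
Hypothesis primeL : forall x y, x * y \in L -> (x \in L) || (y \in L).
Implicit Types (a b : Zbar) (e : E) (x : algC).

Lemma residue_repr e : piL (repr e) = e.
Proof. exact: reprK. Qed.

Lemma residue_eq0 a : (piL a == 0 :> E) = (a \in L).
Proof. by rewrite -[a in RHS]subr0 Quotient.idealrBE -[\pi 0]/(piL 0) rmorph0. Qed.

(** A complex root is an algebraic integer since g is monic, and is then reduced modulo L. *)
Lemma monic_root_residue (g : {poly int}) : g \is monic -> (1 < size g)%N ->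
  exists t : E, root (map_poly intr g) t.
Proof.
move=> mon_g sg; have intrI : injective (intr : int -> algC) := @intr_inj _.
have : size (map_poly (intr : int -> algC) g) != 1%N.
  by rewrite size_map_inj_poly // gtn_eqF.
case/closed_rootP=> t gt.
have tA : t \in Aint.
  by apply/AintP; exists g.
pose t' : Zbar := Sub t tA.
have gt' : (map_poly intr g).[t'] = 0 :> Zbar.
  apply: val_inj; rewrite rmorph0 -(rootP gt).
  rewrite -(horner_map (val : {rmorphism Zbar -> algC})) -map_poly_comp.
  congr (_.[_]); apply: eq_map_poly => k.
  exact: (rmorph_int (val : {rmorphism Zbar -> algC})).
exists (piL t'); apply/rootP; transitivity (piL (map_poly intr g).[t']).
  rewrite -horner_map -map_poly_comp.
  by congr (_.[_]); apply: eq_map_poly => k; rewrite /= rmorph_int.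
by rewrite gt' rmorph0.
Qed.

(** x lies in the localization of Zbar at L and has residue e; the factor [piL b] stays on the
    right, so that nothing is inverted in the quotient ring. *)
Definition congr_residue e x : Prop :=
  exists a b, [/\ b \notin L, x = val a / val b & piL a = e * piL b].

Lemma congr_residue_neq0 e x : (exists e', e * e' = 1) -> congr_residue e x -> x != 0.
Proof.
move=> [e' ee'] [a [b [bL -> ab]]].
have b0 : val b != 0.
  by apply: contraNneq bL => b0; rewrite (_ : b = 0) ?rpred0 //; apply: val_inj.
rewrite mulf_neq0 ?invr_eq0 //; apply: contraNneq bL => a0.
rewrite -residue_eq0 -[piL b]mul1r -ee' mulrAC -ab.
by rewrite (_ : a = 0) ?rmorph0 ?mul0r //; apply: val_inj.
Qed.

Lemma notin_primeM a b : a \notin L -> b \notin L -> a * b \notin L.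
Proof. by move=> aL bL; apply/negP => /primeL; rewrite (negPf aL) (negPf bL). Qed.

Lemma congr_residueM e e' x x' : congr_residue e x -> congr_residue e' x' ->
  congr_residue (e * e') (x * x').
Proof.
move=> [a [b [bL -> ab]]] [a' [b' [bL' -> ab']]]; exists (a * a'), (b * b').
split; first exact: notin_primeM.
  by rewrite !rmorphM invfM mulrACA.
by rewrite !rmorphM /= ab ab' mulrACA.
Qed.

Lemma congr_residueV e e' x : e * e' = 1 -> congr_residue e x -> congr_residue e' x^-1.
Proof.
move=> ee' [a [b [bL -> ab]]]; exists b, a; split.
- apply: contra bL; rewrite -!residue_eq0 ab => /eqP eb.
  by rewrite -[piL b]mul1r -ee' mulrAC eb mul0r.
- by rewrite invf_div.
- by rewrite ab mulrA [e' * e]mulrC ee' mul1r.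
Qed.

Lemma congr_residue_val a : congr_residue (piL a) (val a).
Proof.
by exists a, 1; rewrite idealr1 rmorph1 divr1 /=; split=> //; rewrite (rmorph1 piL) mulr1.
Qed.

Lemma congr_residue_integral e a : congr_residue e (val a) -> piL a = e.
Proof.
move=> [a' [b [bL aE ab]]].
have b0 : val b != 0.
  by apply: contraNneq bL => b0; rewrite (_ : b = 0) ?rpred0 //; apply: val_inj.
have {}aE : a * b = a' by apply: val_inj; rewrite rmorphM /= aE divfK.
have : (a - repr e) * b \in L.
  by rewrite -residue_eq0 mulrBl aE rmorphB rmorphM /= residue_repr ab subrr.
by case/primeL/orP=> [|/idPn//]; rewrite -residue_eq0 rmorphB /= residue_repr subr_eq0 => /eqP.
Qed.

(** For e = 1 this is the divisibility of the 1-units. In general let c lift e: some factor y - z^i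
    c b of y^n - (c b)^n lies in L, and y / (z^i b) is the wanted root. *)
Lemma congr_residue_root e x n : (0 < n)%N -> (exists e', e * e' = 1) ->
  congr_residue (e ^+ n) x -> exists2 y, congr_residue e y & y ^+ n = x.
Proof.
move=> n0 [e' ee'] [a [b [bL -> ab]]].
have b0 : val b != 0.
  by apply: contraNneq bL => b0; rewrite (_ : b = 0) ?rpred0 //; apply: val_inj.
(* The root of a b^(n-1), which is b times a root of a / b, is integral. *)
pose y := n.-root (val a * val b ^+ n.-1).
have yn : y ^+ n = val a * val b ^+ n.-1 by rewrite rootCK.
have yA : y \in Aint.
  by apply: (Aint_root n0); rewrite yn; apply: rpredM (valP a) _; apply: rpredX (valP b).
have [z zprim] := C_prim_root_exists n0.
have zA : z \in Aint by apply: Aint_prim_root zprim.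
pose Y : Zbar := Sub y yA; pose Z : Zbar := Sub z zA.
pose c := repr e; have pc : piL c = e by rewrite /c residue_repr.
have prodE : \prod_(0 <= i < n) (Y - Z ^+ i * (c * b)) = b ^+ n.-1 * (a - c ^+ n * b).
  have VY : zval Y = y by []. have VZ : zval Z = z by [].
  apply: (val_inj : injective zval).
  rewrite rmorph_prod !(rmorphM, rmorphB, rmorphXn).
  have -> : \prod_(0 <= i < n) zval (Y - Z ^+ i * (c * b)) =
      \prod_(0 <= i < n) (y - z ^+ i * (zval c * zval b)).
    by apply: eq_bigr => i _; rewrite !(rmorphM, rmorphB, rmorphXn) VY VZ.
  have yn' : y ^+ n = zval a * zval b ^+ n.-1 by [].
  set A := zval a in yn' *; set B := zval b in b0 yn' *; set w := zval c * B.
  have e2 : B ^+ n.-1 * (A - zval c ^+ n * B) = y ^+ n - w ^+ n.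
    have Bn : B ^+ n = B ^+ n.-1 * B by rewrite -exprSr prednK.
    by rewrite yn' exprMn Bn; ring.
  (* The factorization of X^n - 1 is evaluated at y / w, so w = 0 is treated apart. *)
  rewrite e2; have [->|w0] := eqVneq w 0.
    under eq_bigr => i _ do rewrite mulr0 subr0.
    by rewrite prodr_const_nat subn0 expr0n gtn_eqF // subr0.
  have := factor_Xn_sub_1 zprim => /(congr1 (horner^~ (y / w))).
  rewrite horner_prod !hornerE => e1.
  transitivity (w ^+ n * ((y / w) ^+ n - 1)); last first.
    by rewrite mulrBr mulr1 -exprMn mulrC divfK.
  rewrite -e1 -[in w ^+ n](subn0 n) -prodr_const_nat -big_split /=.
  apply: eq_bigr => i _; transitivity (w * (y / w - z ^+ i)); last by rewrite !hornerE.
  by rewrite -/w; field.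
have : \prod_(0 <= i < n) (Y - Z ^+ i * (c * b)) \in L.
  rewrite prodE; apply: idealMr; rewrite -residue_eq0 rmorphB rmorphM rmorphXn /= pc.
  by rewrite ab subrr.
have prodL (s : seq nat) (f : nat -> Zbar) : \prod_(i <- s) f i \in L ->
    exists i, f i \in L.
  elim: s => [|i s IH]; rewrite ?big_nil ?idealr1 // big_cons.
  by case/primeL/orP=> [fi|/IH]; [exists i|].
case/prodL=> i iL.
have Zn : Z ^+ n = 1 by apply: val_inj; rewrite rmorphXn rmorph1 /= prim_expr_order.
(* Z^i is a unit of Zbar. *)
have ziL : Z ^+ i * b \notin L.
  apply: contra bL => /(idealMr (Z ^+ (i * n.-1))).
  by rewrite mulrA -exprD addnC -mulnS prednK // mulnC exprM Zn expr1n mul1r.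
exists (val Y / val (Z ^+ i * b)).
  exists Y, (Z ^+ i * b); split=> //.
  by apply/eqP; rewrite -pc -rmorphM -subr_eq0 -rmorphB residue_eq0 mulrCA.
have zib : zval (Z ^+ i * b) ^+ n = zval b ^+ n.
  by rewrite -rmorphXn exprMn -exprM mulnC exprM Zn expr1n mul1r rmorphXn.
rewrite expr_div_n (zib : val (Z ^+ i * b) ^+ n = val b ^+ n) (yn : val Y ^+ n = _).
have -> : val b ^+ n = val b ^+ n.-1 * val b by rewrite -exprSr prednK.
by field; rewrite b0 expf_neq0.
Qed.
End Residue.

(** * The group of ideals coprime to m *)

Section CoprimeIdeals.
Local Open Scope classical_set_scope.
Variables (K : fieldExtType rat) (q : quadratic K) (m : set K).
Hypothesis im : integral_ideal m.
Local Notation OO := (@integral_over_Z K).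
Let sm : submodule m := fractional_submodule im.1.

Lemma integral_order : integral_ideal (@order_set K).
Proof. by split=> //; apply: fractional_order. Qed.

Lemma integral_mul_ideal (A B : set K) :
  integral_ideal A -> integral_ideal B -> integral_ideal (mul_ideal A B).
Proof.
move=> [fA AO] [fB BO]; split; first exact: fractional_mul.
suff: mul_ideal A B `<=` @order_set K by [].
apply: mul_ideal_le; first exact: order_submodule.
by move=> x y /AO xO /BO yO; apply: rpredM.
Qed.

Lemma integral_principal (a : K) : a \in OO -> a != 0 -> integral_ideal (principal_ideal a).
Proof.
move=> aO a0; split; last by move=> x /principalP[c cO ->]; apply: rpredM.
by apply: fractional_principal => //; exists 1; rewrite ?rpred1 ?oner_neq0 ?mul1r.
Qed.

Lemma ideals_coprime_order : ideals_coprime_to m (@order_set K).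
Proof.
split; first exact: fractional_order.
exists (@order_set K), (@order_set K); split; try exact: integral_order.
- exact: coprime_order_ideal.
- exact: coprime_order_ideal.
- exact/mul_order_ideal/order_submodule.
Qed.

Lemma ideals_coprime_mul (I J : set K) : ideals_coprime_to m I ->
  ideals_coprime_to m J -> ideals_coprime_to m (mul_ideal I J).
Proof.
move=> [fI [A [B [iA iB cA cB IB]]]] [fJ [A' [B' [iA' iB' cA' cB' JB]]]].
split; first exact: fractional_mul.
exists (mul_ideal A A'), (mul_ideal B B'); split.
- exact: integral_mul_ideal.
- exact: integral_mul_ideal.
- exact: coprime_mul.
- exact: coprime_mul.
- rewrite -IB -JB -!mul_idealA; congr (mul_ideal I _).
  by rewrite mul_idealA [mul_ideal J B]mul_idealC -mul_idealA.
Qed.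

Lemma ideals_coprime_inv (I : set K) :
  ideals_coprime_to m I -> ideals_coprime_to m (inv_ideal I).
Proof.
move=> [fI [A [B [iA iB cA cB IB]]]]; split; first exact: fractional_inv.
exists B, A; split=> //; rewrite -IB; apply: (mul_inv_cancel q) => //.
exact/fractional_submodule/iB.1.
Qed.

(** I(m) is written additively to match [hom_extension]: there [*+] and [*~] stand for powers of
    ideals. *)
Lemma ideals_coprime_zmod : exists (V : zmodType) (f : V -> set K),
  [/\ forall v, ideals_coprime_to m (f v),
      forall I, ideals_coprime_to m I -> exists v, f v = I, injective f,
      forall v w, f (v + w) = mul_ideal (f v) (f w) & f 0 = @order_set K].
Proof.
pose T := {I : set K | ideals_coprime_to m I}.
pose add (v w : T) : T := exist _ _ (ideals_coprime_mul (svalP v) (svalP w)).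
pose opp (v : T) : T := exist _ _ (ideals_coprime_inv (svalP v)).
pose zero : T := exist _ _ ideals_coprime_order.
have addA : associative add by move=> u v w; apply: eq_exist; apply: mul_idealA.
have addC : commutative add by move=> u v; apply: eq_exist; apply: mul_idealC.
have add0 : left_id zero add.
  move=> [I cI]; apply: eq_exist; apply: mul_order_ideal.
  exact/fractional_submodule/cI.1.
have addN : left_inverse zero opp add.
  move=> [I cI]; apply: eq_exist; rewrite mul_idealC.
  exact/(mul_ideal_inv q)/cI.1.
pose C : choiceType := HB.pack T (gen_eqMixin T) (gen_choiceMixin T).
pose V : zmodType := HB.pack T C (GRing.isZmodule.Build C addA addC add0 addN).
exists V, (fun v : V => sval (v : T)); split=> //.
- by move=> v; apply: (svalP (v : T)).
- by move=> I cI; exists (exist _ I cI).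
- by move=> [I cI] [J cJ] /= IJ; apply: eq_exist.
Qed.

Lemma congr1_coprime (a b : integers K) : b != 0 -> val a != 0 ->
  coprime_ideals (principal_ideal (val b)) m -> m (val a - val b) ->
  coprime_ideals (principal_ideal (val a)) m.
Proof.
move=> b0 a0 [x [y [/principalP[c cO ->] my e]]] mab; have [_ _ mM] := sm.
exists (val a * c), (y - c * (val a - val b)); split.
- by apply/principalP; exists c.
- by apply: submoduleB => //; apply: mM.
- by rewrite -e; ring.
Qed.

Lemma val_neq0 (a : integers K) : (val a != 0) = (a != 0).
Proof. by rewrite -(inj_eq val_inj) rmorph0. Qed.

Lemma congr1_ideals_coprime (alpha : K) : congr1_mod m alpha ->
  ideals_coprime_to m (principal_ideal alpha).
Proof.
move=> [al0 [a [b [b0 cb mab alE]]]].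
have b0' : val b != 0 by rewrite val_neq0.
have a0 : val a != 0 by apply: contraNneq al0 => a0; rewrite alE a0 mul0r.
split.
  apply: fractional_principal => //; exists (val b); first exact: valP.
  by rewrite alE mulrC divfK //; split=> //; apply: valP.
exists (principal_ideal (val a)), (principal_ideal (val b)); split=> //.
- exact: integral_principal (valP a) a0.
- exact: integral_principal (valP b) b0'.
- exact: congr1_coprime mab.
- by rewrite principal_mul alE divfK.
Qed.

Lemma congr1_1 : congr1_mod m 1.
Proof.
split; first exact: oner_neq0.
exists 1, 1; rewrite oner_neq0 subrr divr1; split=> //; last by case: sm.
by rewrite principal1; apply: coprime_order_ideal.
Qed.

Lemma congr1_mul (x y : K) : congr1_mod m x -> congr1_mod m y -> congr1_mod m (x * y).
Proof.
move=> [x0 [a [b [b0 cb mab xE]]]] [y0 [c [d [d0 cd mcd yE]]]].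
have [_ mD mM] := sm.
split; first by rewrite mulf_neq0.
exists (a * c), (b * d); rewrite -val_neq0 !rmorphM /= mulf_neq0 ?val_neq0 //; split=> //.
- rewrite -principal_mul; apply: coprime_mul => //.
  by apply: integral_principal (valP b) _; rewrite val_neq0.
- have -> : val a * val c - val b * val d =
    val a * (val c - val d) + val d * (val a - val b) by ring.
  by apply: mD; apply: mM => //; apply: valP.
- by rewrite xE yE invfM mulrACA.
Qed.

Lemma congr1_inv (x : K) : congr1_mod m x -> congr1_mod m x^-1.
Proof.
move=> [x0 [a [b [b0 cb mab xE]]]]; split; first by rewrite invr_eq0.
have a0 : val a != 0 by apply: contraNneq x0 => a0; rewrite xE a0 mul0r.
exists b, a; split.
- by rewrite -val_neq0.
- exact: congr1_coprime mab.
- rewrite -opprB -mulN1r; have [_ _ mM] := sm; apply: mM => //.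
  by rewrite rpredN rpred1.
- by rewrite xE invf_div.
Qed.

(** For x = a / b one has b (x - 1) = a - b in m, and b is invertible modulo m. *)
Lemma congr1_integral (x : K) : x \in OO -> congr1_mod m x -> m (x - 1).
Proof.
move=> xO [x0 [a [b [b0 [z [y [/principalP[c cO zE] my e]]] mab xE]]]].
have [_ mD mM] := sm; have b0' : val b != 0 by rewrite val_neq0.
have -> : x - 1 = c * (val a - val b) + (x - 1) * y.
  have -> : y = 1 - val b * c by rewrite -e zE addrC addKr.
  have -> : val a = x * val b by rewrite xE divfK.
  by ring.
by apply: mD; apply: mM => //; rewrite rpredB ?rpred1.
Qed.
End CoprimeIdeals.

(** * Primes of K above ell and units congruent to 1 *)

Section PrimeOverEll.
Local Open Scope classical_set_scope.
Variables (K : fieldExtType rat) (q : quadratic K).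
Local Notation OO := (@integral_over_Z K).

Lemma mem_ideal_set (l : {pred integers K}) (c : integers K) :
  ideal_set l (val c) <-> c \in l.
Proof. by split=> [[d dl /val_inj <-]|cl]; [|exists c]. Qed.

Lemma ideal_set_integral (l : {pred integers K}) x : ideal_set l x -> x \in OO.
Proof. by case=> c _ <-; apply: valP. Qed.

Lemma ideal_set_submodule (l : idealr (integers K)) : submodule (ideal_set l).
Proof.
split=> [|_ _ [c cl <-] [d dl <-]|x _ xO [c cl <-]].
- by exists 0; rewrite /= ?idealr0.
- by exists (c + d); rewrite /= ?rpredD.
- by exists (Sub x xO * c); rewrite /= ?idealMr.
Qed.

Lemma ideal_set_fractional (l : idealr (integers K)) (c : integers K) :
  c \in l -> c != 0 -> fractional_ideal (ideal_set l).
Proof.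
move=> cl c0; apply: submodule_fractional; first exact: ideal_set_submodule.
  by exists (val c); [apply/mem_ideal_set|rewrite val_neq0].
exists 1; rewrite oner_neq0 rpred1; split=> // x /ideal_set_integral.
by rewrite mul1r.
Qed.

Lemma ideal_set_proper (l : idealr (integers K)) : ~ ideal_set l 1.
Proof. by move/(mem_ideal_set l 1); rewrite idealr1. Qed.

Variables (m : set K) (ell n : nat) (F : finFieldType) (l : idealr (integers K)).
Hypotheses (im : integral_ideal m) (hell : prime ell) (hF : #|F| = (ell ^ n)%N).
Hypotheses (hl : ell%:R \in l) (ml : m `<=` ideal_set l).
Hypothesis (unitsF : units_embed (integers K) F).

Lemma ell_eq0 : ell%:R = 0 :> F.
Proof.
have /andP[_ /eqP //] : ell \in [pchar F] by apply: (card_finPcharP hF).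
Qed.

(** Otherwise Bezout puts 1 in l, which is proper. *)
Lemma ell_dvd (c : nat) : c%:R \in l -> (ell %| c)%N.
Proof.
move=> cl; apply/negPn/negP; rewrite -prime_coprime // => co.
have /coprimezP[[u v] /= uv] : coprimez c ell by rewrite coprimezE coprime_sym.
have : u%:~R * c%:R + v%:~R * ell%:R \in l.
  by apply: rpredD; apply: idealMr.
have -> : u%:~R * c%:R + v%:~R * ell%:R = (u * c + v * ell)%:~R :> integers K.
  by rewrite intrD !intrM.
by rewrite uv idealr1.
Qed.

(** Such a unit has norm 1, hence integral trace t with t^2 <= 4, and (conjq x - 1) (x - 1) = 2 - t
    lies in l, so ell divides 2 - t. In the remaining cases the order of x is a power of ell, and
    the unit group of F has no element of order ell. *)
Lemma unit_congr1_eq1 (x : K) : x \in OO -> x^-1 \in OO -> congr1_mod m x -> x = 1.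
Proof.
move=> xO xVO cx; have x0 : x != 0 by case: cx.
have nx1 : normq q x = 1.
  have [a aE] := normq_integral_nat q xO; have [b bE] := normq_integral_nat q xVO.
  have : (a * b)%:R = 1 :> rat.
    by rewrite natrM -aE -bE -normqM mulfV // -(rmorph1 (@ratK K)) normq_ratK expr1n.
  by move/eqP; rewrite pnatr_eq1 muln_eq1 => /andP[/eqP a1 _]; rewrite aE a1.
have xl : ideal_set l (x - 1) by apply/ml/(congr1_integral im).
have cjx : x * conjq q x = 1 by rewrite conjq_mul nx1 rmorph1.
have /intrP[t tE] : qre q x *+ 2 \is a Num.int.
  by move: xO; rewrite (integral_quad q) => /andP[].
have cjt : x + conjq q x = t%:~R by rewrite conjq_add tE rmorph_int.
have t2 : (t ^+ 2 <= 4)%R.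
  rewrite -(ler_int rat) rmorphXn /= -tE.
  move: nx1; rewrite /normq; have : 0 <= (qD q)%:R * qim q x ^+ 2 by rewrite mulr_ge0 ?sqr_ge0.
  by move: (qre q x) (_ * _) => u v; nra.
have lt : ideal_set l (2 - t)%:~R.
  have -> : (2 - t)%:~R = (conjq q x - 1) * (x - 1) :> K.
    by rewrite intrB -cjt; ring: cjx.
  have [_ _ lM] := ideal_set_submodule l; apply: lM => //.
  by rewrite rpredB ?rpred1 ?integral_conjq.
have dvd : (ell %| absz (2 - t))%N.
  apply: ell_dvd; apply/mem_ideal_set; rewrite rmorph_nat.
  have : 0 <= 2 - t by nia.
  by case: (2 - t)%R lt => // k.
have quad : x ^+ 2 = t%:~R * x - 1 by rewrite -cjt; ring: cjx.
have [f [fM finj]] := unitsF.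
have unitx (k : nat) : exists y, (Sub x xO : integers K) ^+ k * y = 1.
  exists ((Sub (x^-1) xVO) ^+ k); rewrite -exprMn; apply: val_inj.
  by rewrite rmorphXn rmorphM /= mulfV // expr1n.
have f1 : f 1 = 1%g.
  by apply: (mulgI (f 1)); rewrite mulg1 -fM ?mulr1 //; exists 1; rewrite mulr1.
have fX k : f ((Sub x xO) ^+ k) = (f (Sub x xO) ^+ k)%g.
  elim: k => [|k IH]; first by rewrite expr0 f1.
  by rewrite exprS fM ?IH ?expgS //; exact: (unitx 1%N).
have ellF := ell_eq0.
(* Used with k a power of ell: then X^k = 1 forces X = 1 in F, and injectivity of f carries this
   back to x. *)
have root1 k : x ^+ k = 1 ->
    (val (f (Sub x xO)) ^+ k = 1 :> F -> val (f (Sub x xO)) = 1 :> F) -> x = 1.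
  move=> xk fk; suff : Sub x xO = 1 :> integers K by move/(congr1 val).
  apply: finj; [exact: (unitx 1%N)|by exists 1; rewrite mulr1|].
  rewrite f1; apply: val_inj; apply: fk; rewrite -FinRing.val_unitX -fX.
  have -> : (Sub x xO : integers K) ^+ k = 1 by apply: val_inj; rewrite rmorphXn.
  by rewrite f1.
have root2 : ell = 2%N -> x ^+ 4 = 1 -> x = 1.
  move=> l2 x4; rewrite l2 in ellF; apply: (root1 _ x4); move: (val _) => X X4.
  have : (X - 1) ^+ 4 = X ^+ 4 - 1 + 2%:R * (1 - 2%:R * X ^+ 3 + 3%:R * X ^+ 2 - 2%:R * X).
    by ring.
  by rewrite X4 ellF subrr mul0r addr0 => /eqP; rewrite expf_eq0 subr_eq0 => /eqP.
have root3 : ell = 3%N -> x ^+ 3 = 1 -> x = 1.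
  move=> l3 x3; apply: (root1 _ x3); move: (val _) => X X3.
  have : (X - 1) ^+ 3 = X ^+ 3 - 1 - 3%:R * (X ^+ 2 - X) by ring.
  rewrite l3 in ellF.
  by rewrite X3 ellF subrr mul0r subr0 => /eqP; rewrite expf_eq0 subr_eq0 => /eqP.
(* t = 2 gives (x - 1)^2 = 0; t = 1 makes ell divide 1; t = 0 and t = -2 force ell = 2 with x^4 = 1;
   t = -1 forces ell = 3 with x^3 = 1. *)
have : t \in [:: 2; 1; 0; -1; -2] by rewrite !inE; nia.
rewrite !inE => /or4P[/eqP tv|/eqP tv|/eqP tv|/orP[]/eqP tv]; rewrite tv in quad dvd.
- suff : (x - 1) ^+ 2 = 0 by move/eqP; rewrite expf_eq0 subr_eq0 => /eqP.
  by rewrite sqrrB quad; ring.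
- by move: dvd hell; rewrite dvdn1 => /eqP ->.
- apply: root2; first by apply/eqP; move: dvd; rewrite dvdn_prime2.
  by rewrite (exprM _ 2 2) quad; ring.
- apply: root3; first by apply/eqP; move: dvd; rewrite dvdn_prime2.
  by rewrite exprS quad mulrBr mulrCA -expr2 quad; ring.
- have x1 : x = -1.
    suff : (x + 1) ^+ 2 = 0 by move/eqP; rewrite expf_eq0 addr_eq0 => /eqP.
    by rewrite sqrrD quad; ring.
  apply: root2; last by rewrite x1; ring.
  have : (ell %| 2 ^ 2)%N by [].
  by rewrite Euclid_dvdX // andbT dvdn_prime2 // => /eqP.
Qed.
End PrimeOverEll.

(** * Maximal ideals of Zbar above a prime of K *)

Section IntegersInZbar.
Local Open Scope classical_set_scope.
Variables (K : fieldExtType rat) (iota : {rmorphism K -> algC}) (q : quadratic K).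

Lemma iota_int_subproof (c : integers K) : iota (val c) \in Aint.
Proof. by rewrite -iota_integral; apply: valP. Qed.

Definition iota_int (c : integers K) : Zbar := Sub (iota (val c)) (iota_int_subproof c).

Lemma iota_int_zmod : zmod_morphism iota_int.
Proof. by move=> x y; apply: val_inj; rewrite /= !rmorphB. Qed.

Lemma iota_int_monoid : monoid_morphism iota_int.
Proof. by split=> [|x y]; apply: val_inj; rewrite /= ?rmorph1 ?rmorphM. Qed.

HB.instance Definition _ := GRing.isZmodMorphism.Build _ _ iota_int iota_int_zmod.
HB.instance Definition _ := GRing.isMonoidMorphism.Build _ _ iota_int iota_int_monoid.

(* If x lies in the inverse of l but is not integral, then iota x maps the
   extension of l to Zbar into Zbar, so this extension does not contain 1. *)
Lemma prime_over (l : idealr (integers K)) (c : integers K) : c \in l -> c != 0 ->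
  exists L : idealr Zbar, [/\ maximal_ideal L,
    forall x y, x * y \in L -> (x \in L) || (y \in L)
    & forall x, x \in l -> iota_int x \in L].
Proof.
move=> cl c0; have fl := ideal_set_fractional cl c0.
(* If the inverse of l were contained in O, its product with l, which is O, would be contained in
   l. *)
have [x xinv xNO] : exists2 x, inv_ideal (ideal_set l) x & x \notin @integral_over_Z K.
  apply: contrapT => nox; apply: (@ideal_set_proper _ l).
  have := mul_ideal_inv q fl; rewrite mul_idealC => e.
  have : @order_set K 1 by apply: rpred1.
  rewrite -e; apply: mul_ideal_le; first exact: ideal_set_submodule.
  move=> y z yinv lz; have [_ _ lM] := ideal_set_submodule l; apply: lM => //.
  by apply: contrapT => yNO; apply: nox; exists y => //; apply/negP.
pose I := [set iota y | y in ideal_set l]; pose J := [set y | y \in Aint].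
pose S : set Zbar := [set z | mul_ideal I J (zval z)].
have [||||L [maxL SL primeL]] := @exists_maximal_ideal Zbar S.
- exact: mul_ideal0.
- by move=> y z; apply: mul_idealD.
- move=> a y; rewrite /S /mkset rmorphM; move: (zval y).
  apply: (mul_ideal_sub (C := fun y => mul_ideal I J (zval a * y))).
  + by rewrite mulr0; apply: mul_ideal0.
  + by move=> u v; rewrite mulrDr; apply: mul_idealD.
  + move=> u v Iu Jv; rewrite mulrCA; apply: mem_mul_ideal => //.
    by apply: rpredM Jv; apply: (valP a).
- rewrite /S /mkset rmorph1 => S1; case/negP: xNO; rewrite (iota_integral iota) -[iota x]mulr1.
  move: {S1} 1 S1 => w; apply: (mul_ideal_sub (C := fun w => iota x * w \in Aint)).
  + by rewrite mulr0 rpred0.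
  + by move=> u v; rewrite mulrDr; apply: rpredD.
  + move=> _ v [y ly <-] Jv; rewrite mulrA -rmorphM; apply: rpredM => //.
    by rewrite -iota_integral; apply: xinv.
exists L; split=> // y yl; apply: SL; rewrite /S /= -[iota _]mulr1.
by apply: mem_mul_ideal; [exists (val y) => //; apply/mem_ideal_set|apply: rpred1].
Qed.
End IntegersInZbar.

(** * Construction of the Hecke character *)

Lemma divides_ideal_sub (K : fieldExtType rat) (l : idealr (integers K)) (m : set K) x :
  divides_ideal (ideal_set l) m -> m x -> ideal_set l x.
Proof.
move=> [A [_ AO] ->]; move: x; apply: mul_ideal_le; first exact: ideal_set_submodule.
move=> x y lx /AO yO; rewrite mulrC.
by have [_ _ lM] := ideal_set_submodule l; apply: lM.
Qed.

Theorem theorem3p2 (K : fieldExtType rat) (iota : {rmorphism K -> algC})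
    (hK : imaginary_quadratic iota)
    (m : set K) (hm : integral_ideal m)
    (ell n : nat) (hell : prime ell) (hn : (1 <= n)%N)
    (F : finFieldType) (hF : #|F| = (ell ^ n)%N)
    (r : set K -> {unit F})
    (hr : forall I J, ideals_coprime_to m I -> ideals_coprime_to m J ->
       r (mul_ideal I J) = (r I * r J)%g)
    (l : prime_idealr (integers K)) (hl : ell%:R \in l)
    (h1 : units_embed {ideal_quot l} F)
    (h2 : divides_ideal (ideal_set l) m)
    (h3 : units_embed (integers K) F)
    (h4 : forall I, P1 m I -> r I = 1%g) :
  exists L : idealr Zbar,
    [/\ maximal_ideal L, ell%:R \in L,
        inhabited {rmorphism F -> {ideal_quot L}}
      & forall j : {rmorphism F -> {ideal_quot L}},
        exists psi : set K -> algC,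
          hecke_character iota m psi /\
          forall p : prime_idealr (integers K),
            ideals_coprime_to m (ideal_set p) ->
            exists2 z : Zbar, psi (ideal_set p) = val z
              & \pi_({ideal_quot L}) z = j (val (r (ideal_set p)))].
Proof.
have [q] := imaginary_quadratic_coords hK.
have sm := fractional_submodule hm.1.
have ml x : m x -> ideal_set l x by apply: divides_ideal_sub.
have ell0 : (ell%:R : integers K) != 0.
  by rewrite -val_neq0 rmorph_nat natK_eq0 -lt0n prime_gt0.
have [L [maxL primeL lL]] := prime_over iota q hl ell0.
have ellL : ell%:R \in L by rewrite -(rmorph_nat (iota_int iota)); apply: lL.
exists L; split=> //.
  apply: (finField_embedding hell); first exact: (ell_eq0 hell hF).
    by rewrite -(rmorph_nat (residue L)); apply/eqP; rewrite residue_eq0.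
  exact: monic_root_residue.
move=> j; have [V [f [fI fsurj finj fD f0]]] := ideals_coprime_zmod q hm.
pose e v := j (val (r (f v))).
have eD v w : e (v + w) = e v * e w by rewrite /e fD hr // FinRing.val_unitM rmorphM.
have e0 : e 0 = 1.
  have : r (f 0) = 1%g by apply: (mulgI (r (f 0))); rewrite -hr // -fD addr0 mulg1.
  by rewrite /e => ->; rewrite FinRing.val_unit1 rmorph1.
have eN v : e v * e (- v) = 1 by rewrite -eD subrr.
have eMn v k : e (v *+ k) = e v ^+ k.
  by elim: k => [|k IH]; rewrite ?mulr0n ?expr0 // mulrS exprS eD IH.
have eU v : exists e', e v * e' = 1 by exists (e (- v)).
pose good v x := congr_residue (e v) x.
(* The graph of (alpha) |-> alpha on P1(m). It is a relation because alpha is at first determined by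
   its ideal only up to units. *)
pose G0 v x := exists2 alpha, congr1_mod m alpha &
  f v = principal_ideal alpha /\ x = iota alpha.
have [||||||||||psi [psi_good psiD psiG0]] := @hom_extension V algC good G0.
- by move=> v x; apply: congr_residue_neq0.
- by move=> v w x y; rewrite /good eD; apply: congr_residueM.
- by move=> v x; apply: congr_residueV.
- move=> v; exists (val (repr (e v))); rewrite /good -{1}(residue_repr (e v)).
  exact: congr_residue_val.
- by move=> v k s k0; rewrite /good eMn; apply: congr_residue_root.
- move=> v x [alpha calpha [fv ->]]; have [al0 [a [b [b0 cb mab alE]]]] := calpha.
  have -> : good v = @congr_residue L 1.
    rewrite /good /e h4 ?FinRing.val_unit1 ?rmorph1 //.
    by split; [apply: fI|exists alpha].
  exists (iota_int iota a), (iota_int iota b); split.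
  (* b c + y = 1 with y in m, whose image is in L; so b in L would put 1 in L. *)
  + apply/negP => bL; have [x' [y [/principalP[c cO xE] my xy]]] := cb.
    have yO : y \in @integral_over_Z K by apply: hm.2.
    pose c' : integers K := Sub c cO; pose y' : integers K := Sub y yO.
    have e1 : 1 = b * c' + y' by apply: val_inj; rewrite rmorphD rmorphM rmorph1 /= -xy xE.
    have : iota_int iota 1 \in L.
      rewrite e1 rmorphD rmorphM rpredD // 1?mulrC ?idealMr //.
      by apply: lL; apply/mem_ideal_set/ml.
    by rewrite rmorph1 idealr1.
  + by rewrite alE fmorph_div.
  + apply/eqP; rewrite mul1r -subr_eq0 -!rmorphB residue_eq0; apply: lL.
    by apply/mem_ideal_set/ml; rewrite rmorphB.
- by exists 1; [apply: congr1_1|rewrite f0 principal1 rmorph1].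
- move=> v w _ _ [a ca [fv ->]] [b cb [fw ->]]; exists (a * b); first exact: congr1_mul.
  by rewrite fD fv fw principal_mul rmorphM.
- move=> v _ [a ca [fv ->]]; exists a^-1; first exact: congr1_inv.
  have a0 : a != 0 by case: ca.
  split; last by rewrite fmorphV.
  have := fD v (- v); rewrite subrr f0 fv => /(congr1 (mul_ideal (principal_ideal a^-1))).
  rewrite mul_idealA principal_mul mulVf // principal1 mul_order_ideal.
    by rewrite mul_idealC mul_order_ideal //; apply: principal_submodule.
  by have [fr _] := fI (- v); apply: fractional_submodule.
(* Single-valuedness: a generator of the unit ideal is a unit, and congruent to 1 it equals 1. *)
- move=> _ [a ca [f0a ->]]; rewrite f0 in f0a.
  have a0 : a != 0 by case: ca.
  suff -> : a = 1 by rewrite rmorph1.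
  apply: (unit_congr1_eq1 q hm hell hF hl ml h3) => //.
    by have := mem_principal a; rewrite -f0a.
  have : principal_ideal a 1 by rewrite -f0a; apply: rpred1.
  by case/principalP=> c cO /esym/(canRL (mulKf a0)); rewrite mulr1 => <-.
(* [g] inverts [f] on I(m) and takes the default value 0 elsewhere, where psi is unconstrained. *)
have /choice[g gP] : forall I, exists v, ideals_coprime_to m I -> f v = I.
  move=> I; have [cI|nI] := pselect (ideals_coprime_to m I); last by exists 0.
  by have [v fv] := fsurj _ cI; exists v.
exists (psi \o g); split.
  split=> [I cI|I J cI cJ|alpha calpha] /=.
  - exact: congr_residue_neq0 (eU _) (psi_good _).
  - rewrite -psiD; congr psi; apply: finj; rewrite fD !gP //.
    exact: ideals_coprime_mul.
  - apply: psiG0; exists alpha => //; split=> //; apply: gP.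
    exact: congr1_ideals_coprime.
move=> p cp; have [fp [A [B [iA iB cA cB pB]]]] := cp.
have ip : integral_ideal (ideal_set p) by split=> // x; apply: ideal_set_integral.
(* Membership in I(m) only presents p as a quotient of ideals coprime to m; but A = p B is contained
   in p, so p inherits the coprimality of A. *)
have cpm : coprime_ideals (ideal_set p) m.
  have [x [y [Ax my xy]]] := cA; exists x, y; split=> //.
  move: x Ax {xy}; rewrite -pB; apply: mul_ideal_le; first exact: ideal_set_submodule.
  move=> x y' px /iB.2 yO; rewrite mulrC.
  by have [_ _ pM] := ideal_set_submodule p; apply: pM.
have [k [a [k0 aO ca pk]]] := coprime_ideal_exp_P1 q hm ip cpm.
pose v := g (ideal_set p); have fv : f v = ideal_set p by apply: gP.
have fk i : f (v *+ i) = ideal_exp (ideal_set p) i.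
  by elim: i => [|i IH]; [rewrite mulr0n f0|rewrite mulrS fD IH fv].
have psik i : psi (v *+ i) = psi v ^+ i.
  elim: i => [|i IH]; last by rewrite mulrS psiD IH exprS.
  rewrite mulr0n expr0; apply: psiG0; exists 1; first exact: congr1_1.
  by rewrite f0 principal1 rmorph1.
have psiA : psi v \in Aint.
  apply: (Aint_root k0); rewrite -psik (psiG0 _ (iota a)) -?iota_integral //.
  by exists a => //; rewrite fk.
exists (Sub (psi v) psiA) => //.
(* Now that psi(p) is integral and L is prime, the congruence of fractions is an equality in the
   quotient of Zbar. *)
rewrite -fv; apply: (congr_residue_integral primeL).
exact: psi_good.
Qed.
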